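(* Let $\hat u\in\mathcal U_{ad}$ be a weak minimum of the problem $\min\{F(u):u\in\mathcal U_{ad}\}$. Let $\hat\Psi=\Psi[\hat u]$, $\hat p=p[\hat u]$ and $\Lambda(t)=\alpha+\langle\hat p(t),\mathcal B_1+\mathcal B_2\hat\Psi(t)\rangle$. Then, up to sets of Lebesgue measure zero, $$\{t\in(0,T):\Lambda(t)>0\}\subset\{t\in(0,T):\hat u(t)=u_m\},\qquad \{t\in(0,T):\Lambda(t)<0\}\subset\{t\in(0,T):\hat u(t)=u_M\}.$$
   Context: $\mathcal H$ is a reflexive (real) Banach space, $\langle\cdot,\cdot\rangle$ the pairing between $\mathcal H^*$ and $\mathcal H$, $T>0$. The operator $\mathcal A$ (possibly unbounded) is the generator of a strongly continuous semigroup $e^{-t\mathcal A}$ on $\mathcal H$, with the sign convention $\mathcal Ay=-\lim_{t\downarrow0}(e^{-t\mathcal A}y-y)/t$. Data: $\Psi_0\in\mathcal H$, $f\in L^1(0,T;\mathcal H)$, $\mathcal B_1\in\mathcal H$, $\mathcal B_2\in\mathcal L(\mathcal H)$. For $u\in L^1(0,T)$, the state $\Psi[u]\in C([0,T];\mathcal H)$ is the unique mild solution of $\dot\Psi+\mathcal A\Psi=f+u(\mathcal B_1+\mathcal B_2\Psi)$, $\Psi(0)=\Psi_0$, i.e. $\Psi(t)=e^{-t\mathcal A}\Psi_0+\int_0^te^{-(t-s)\mathcal A}\big(f(s)+u(s)(\mathcal B_1+\mathcal B_2\Psi(s))\big)ds$. Cost: $Q,Q_T\in\mathcal L(\mathcal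 H,\mathcal H^* )$ are symmetric, $q(y)=\langle Qy,y\rangle$, $q_T(y)=\langle Q_Ty,y\rangle$, $\Psi_d\in L^\infty(0,T;\mathcal H)$, $\Psi_{dT}\in\mathcal H$, $\alpha\in\mathbb R$, and $$J(u,\Psi)=\alpha\int_0^Tu(t)\,dt+\tfrac12\int_0^Tq(\Psi(t)-\Psi_d(t))\,dt+\tfrac12q_T(\Psi(T)-\Psi_{dT}),\qquad F(u)=J(u,\Psi[u]).$$ Admissible controls: $\mathcal U_{ad}=\{u\in L^1(0,T):u_m\le u(t)\le u_M\text{ a.e.}\}$ with constants $u_m<u_M$. A control $\hat u\in\mathcal U_{ad}$ is a weak minimum if $F(\hat u)\le F(u)$ for all $u\in\mathcal U_{ad}$ sufficiently close to $\hat u$ in the norm of $L^\infty(0,T)$. The costate $p[u]\in C([0,T];\mathcal H^* )$ is the mild (backward) solution of $-\dot p+\mathcal A^*p=Q(\Psi-\Psi_d)+u\mathcal B_2^*p$, $p(T)=Q_T(\Psi(T)-\Psi_{dT})$ with $\Psi=\Psi[u]$, i.e. $p(t)=e^{-(T-t)\mathcal A^*}p(T)+\int_t^Te^{-(s-t)\mathcal A^*}\big(Q(\Psi(s)-\Psi_d(s))+u(s)\mathcal B_2^*p(s)\big)ds$. *)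

(* Defs.v *)
From HB Require Import structures.
From mathcomp Require Import all_boot all_order all_algebra.
From mathcomp Require Import all_classical all_reals all_analysis.

Set Implicit Arguments.
Unset Strict Implicit.
Unset Printing Implicit Defensive.

Import Order.TTheory GRing.Theory Num.Theory.
Import numFieldNormedType.Exports.

Local Open Scope classical_set_scope.
Local Open Scope ring_scope.

Section BoundedOperators.
Context (R : realType) (V W : normedModType R).

Definition bop_pred : {pred V -> W} :=
  mem [set f : V -> W | linear f /\ continuous f].

Record bop := BOp { bop_fun :> V -> W ; _ : bop_fun \in bop_pred }.

HB.instance Definition _ := [isSub for bop_fun].
HB.instance Definition _ := [Choice of bop by <:].

Lemma bop_submod_closed : submod_closed bop_pred.
Proof.
split.
  rewrite inE; split; last by move=> x; exact: cvg_cst.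
  by move=> a x y; rewrite -[LHS]/(0 : W) -[RHS]/(a *: 0 + 0 : W) scaler0 addr0.
move=> a f g; rewrite !inE => -[lf cf] [lg cg]; split.
  move=> b x y; rewrite -[LHS]/(a *: f _ + g _) lf lg.
  rewrite -[RHS]/(b *: (a *: f x + g x) + (a *: f y + g y)).
  by rewrite !scalerDr !scalerA (mulrC a b) addrACA.
by move=> x; apply: cvgD; [apply: cvgZr; exact: cf | exact: cg].
Qed.

HB.instance Definition _ :=
  GRing.isSubmodClosed.Build R (V -> W) bop_pred bop_submod_closed.
HB.instance Definition _ := [SubChoice_isSubLmodule of bop by <:].

Lemma bop_is_linear (f : bop) : linear f.
Proof. by case: f => f /= /set_mem[]. Qed.

HB.instance Definition _ (f : bop) :=
  GRing.isLinear.Build R V W *:%R (bop_fun f) (bop_is_linear f).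

Lemma bop_continuous (f : bop) : continuous f.
Proof. by case: f => f /= /set_mem[]. Qed.

Lemma bopP (f g : bop) : (forall x, f x = g x) -> f = g.
Proof. by move=> fg; apply/val_inj/funext. Qed.

Definition opnorm (f : bop) : R := sup [set `|f x| | x in [set x | `|x| <= 1]].

Lemma bop_bounded (f : bop) : exists2 M, 0 <= M & forall x, `|f x| <= M * `|x|.
Proof.
have /linear_boundedP/pinfty_ex_gt0[M M0 fM] : bounded_near f (nbhs (0 : V)).
  by apply/linear_bounded_continuous; exact: bop_continuous.
by exists M => //; exact: ltW.
Qed.

Lemma opnorm_has_sup (f : bop) :
  has_sup [set `|f x| | x in [set x | `|x| <= 1]].
Proof.
split; first by exists `|f 0|, 0 => //=; rewrite normr0.
have [M M0 fM] := bop_bounded f; exists M => _ [x /= x1 <-].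
by rewrite (le_trans (fM x))// ler_piMr.
Qed.

Lemma opnorm_ge0 (f : bop) : 0 <= opnorm f.
Proof.
have /ubP := sup_upper_bound (opnorm_has_sup f); apply.
by exists 0; rewrite /= ?normr0 ?linear0 ?normr0.
Qed.

Lemma opnorm_ler (f : bop) x : `|f x| <= opnorm f * `|x|.
Proof.
have [->|x0] := eqVneq x 0; first by rewrite linear0 !normr0 mulr0.
have x_gt0 : 0 < `|x| by rewrite normr_gt0.
rewrite -ler_pdivrMr//.
have -> : `|f x| / `|x| = `|f (`|x|^-1 *: x)|.
  by rewrite linearZ /= normrZ normfV normr_id mulrC.
have /ubP := sup_upper_bound (opnorm_has_sup f); apply.
exists (`|x|^-1 *: x) => //=.
by rewrite normrZ normfV normr_id mulVf// gt_eqF.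
Qed.

Lemma opnorm_le (f : bop) (M : R) :
  0 <= M -> (forall x, `|f x| <= M * `|x|) -> opnorm f <= M.
Proof.
move=> M0 fM; apply: ge_sup; first exact: (opnorm_has_sup f).1.
by move=> _ [x /= x1 <-]; rewrite (le_trans (fM x))// ler_piMr.
Qed.

Lemma opnormD (f g : bop) : opnorm (f + g) <= opnorm f + opnorm g.
Proof.
apply: opnorm_le => [|x]; first by rewrite addr_ge0// opnorm_ge0.
by rewrite mulrDl (le_trans (ler_normD _ _))// lerD// opnorm_ler.
Qed.

Lemma opnormZ (a : R) (f : bop) : opnorm (a *: f) = `|a| * opnorm f.
Proof.
have le_opnormZ b h : opnorm (b *: h) <= `|b| * opnorm h.
  apply: opnorm_le => [|x]; first by rewrite mulr_ge0// opnorm_ge0.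
  by rewrite normrZ -mulrA ler_wpM2l// opnorm_ler.
apply/eqP; rewrite eq_le le_opnormZ /=.
have [->|a0] := eqVneq a 0; first by rewrite normr0 mul0r opnorm_ge0.
rewrite -ler_pdivlMl ?normr_gt0// -normfV (le_trans _ (le_opnormZ _ _))//.
by rewrite scalerA mulVf// scale1r.
Qed.

Lemma opnorm0_eq0 (f : bop) : opnorm f = 0 -> f = 0.
Proof.
move=> f0; apply: bopP => x; apply/eqP; rewrite -normr_le0.
by rewrite (le_trans (opnorm_ler f x))// f0 mul0r.
Qed.

HB.instance Definition _ :=
  Lmodule_isNormed.Build R bop opnormD opnormZ opnorm0_eq0.

End BoundedOperators.

Notation "''L' ( V , W )" := (bop V W) (at level 8, format "''L' ( V ,  W )").

(* The continuous dual of V is 'L(V, R^o); it carries the dual norm. *)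
Section Adjoint.
Context (R : realType) (V W : normedModType R).

Definition adj_fun (G : 'L(V, W)) (phi : 'L(W, R^o)) : V -> R^o := phi \o G.

Lemma adj_fun_bop (G : 'L(V, W)) (phi : 'L(W, R^o)) :
  adj_fun G phi \in @bop_pred R V R^o.
Proof.
rewrite inE; split=> [a x y|x]; first by rewrite /adj_fun /= !linearP.
by apply: continuous_comp; exact: bop_continuous.
Qed.

Definition adj_val (G : 'L(V, W)) (phi : 'L(W, R^o)) : 'L(V, R^o) :=
  BOp (adj_fun_bop G phi).

Lemma adj_bop (G : 'L(V, W)) : adj_val G \in @bop_pred R 'L(W, R^o) 'L(V, R^o).
Proof.
have adj_lin : linear (adj_val G) by move=> a phi psi; exact: bopP.
rewrite inE; split=> //.
pose A : {linear 'L(W, R^o) -> 'L(V, R^o)} :=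
  HB.pack (adj_val G) (GRing.isLinear.Build R _ _ *:%R (adj_val G) adj_lin).
apply: (@bounded_linear_continuous _ _ _ A); apply/linear_boundedP.
exists (opnorm G); split=> [|M GM phi]; first exact: num_real.
have M0 : 0 <= M by rewrite (le_trans (opnorm_ge0 G))// ltW.
apply: opnorm_le => [|x]; first by rewrite mulr_ge0// opnorm_ge0.
rewrite (le_trans (opnorm_ler phi (G x)))// mulrAC mulrC.
rewrite ler_wpM2r ?opnorm_ge0// (le_trans (opnorm_ler G x))//.
by rewrite ler_wpM2r// ltW.
Qed.

Definition adj (G : 'L(V, W)) : 'L('L(W, R^o), 'L(V, R^o)) := BOp (adj_bop G).

End Adjoint.

Definition reflexive_space (R : realType) (V : normedModType R) : Prop :=
  forall Phi : 'L('L(V, R^o), R^o),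
    exists x : V, forall phi : 'L(V, R^o), Phi phi = phi x.

(* Measurability is Borel measurability throughout: a class of a.e. equal      *)
(* functions is handled through a representative that is a pointwise limit of  *)
(* Borel simple functions.  In particular the norms integrated below are Borel *)
(* functions, which matters since the library integral of a non-measurable     *)
(* function is only a lower integral.                                          *)
Section Bochner.
Context (R : realType) (V : normedModType R).

(* \sum_(i < n) \1_(A i) c_i ; the sets need not be disjoint. *)
Record simple_fun := SimpleFun {
  sf_size : nat ;
  sf_set : 'I_sf_size -> set R ;
  sf_coef : 'I_sf_size -> V ;
  sf_measurable : forall i, measurable (sf_set i) ;
  sf_finite : forall i, (lebesgue_measure (sf_set i) < +oo)%E }.

Definition sf_eval (s : simple_fun) (t : R) : V :=
  \sum_(i < sf_size s) (\1_(sf_set i) t : R) *: sf_coef i.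

Definition sf_integral (D : set R) (s : simple_fun) : V :=
  \sum_(i < sf_size s) fine (lebesgue_measure (sf_set i `&` D)) *: sf_coef i.

Definition strongly_measurable (D : set R) (f : R -> V) : Prop :=
  exists s : nat -> simple_fun,
    forall t, D t -> sf_eval (s n) t @[n --> \oo] --> f t.

Definition bochner_L1 (D : set R) (f : R -> V) : Prop :=
  strongly_measurable D f /\
  (\int[lebesgue_measure]_(t in D) `|f t|%:E < +oo)%E.

Definition bochner_Linfty (D : set R) (f : R -> V) : Prop :=
  strongly_measurable D f /\
  exists M : R, {ae lebesgue_measure, forall t, D t -> `|f t| <= M}.

(* f is Bochner integrable on D, with integral v *)
Definition has_bochner_integral (D : set R) (f : R -> V) (v : V) : Prop :=
  strongly_measurable D f /\
  exists s : nat -> simple_fun,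
    (\int[lebesgue_measure]_(t in D) `|f t - sf_eval (s n) t|%:E)%E
      @[n --> \oo] --> 0%E /\
    sf_integral D (s n) @[n --> \oo] --> v.

End Bochner.

Section Problem.
Context (R : realType) (H : completeNormedModType R).

Definition C0_semigroup (S : R -> 'L(H, H)) : Prop :=
  [/\ forall y, S 0 y = y,
      forall s t, 0 <= s -> 0 <= t -> forall y, S (s + t) y = S s (S t y) &
      forall y, S t y @[t --> 0^'+] --> y].

(* A, with domain dom, is minus the usual infinitesimal generator of S. *)
Definition generates (dom : set H) (A : H -> H) (S : R -> 'L(H, H)) : Prop :=
  forall y z, (dom y /\ A y = z) <->
              t^-1 *: (S t y - y) @[t --> 0^'+] --> - z.

Definition mild_state (T : R) (S : R -> 'L(H, H)) (f : R -> H) (B1 : H)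
    (B2 : 'L(H, H)) (Psi0 : H) (u : R -> R) (Psi : R -> H) : Prop :=
  {within `[0, T], continuous Psi} /\
  forall t, t \in `[0, T] -> exists2 v : H,
    has_bochner_integral `]0, t[
      (fun s => S (t - s) (f s + u s *: (B1 + B2 (Psi s)))) v &
    Psi t = S t Psi0 + v.

(* Psi[u].  For 0 < T, f and u integrable, a mild solution exists and is       *)
(* unique on [0, T], so xget never takes its default value; the values outside *)
(* [0, T] are unspecified.                                                     *)
Definition state (T : R) (S : R -> 'L(H, H)) (f : R -> H) (B1 : H)
    (B2 : 'L(H, H)) (Psi0 : H) (u : R -> R) : R -> H :=
  xget (cst 0) [set Psi | mild_state T S f B1 B2 Psi0 u Psi].

(* adj (S t) is e^{-tA^*}, the adjoint of e^{-tA}. *)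
Definition mild_costate (T : R) (S : R -> 'L(H, H)) (B2 : 'L(H, H))
    (Q QT : 'L(H, 'L(H, R^o))) (Psid : R -> H) (PsidT : H)
    (u : R -> R) (Psi : R -> H) (p : R -> 'L(H, R^o)) : Prop :=
  [/\ {within `[0, T], continuous p},
      p T = QT (Psi T - PsidT) &
      forall t, t \in `[0, T] -> exists2 v : 'L(H, R^o),
        has_bochner_integral `]t, T[
          (fun s => adj (S (s - t))
                      (Q (Psi s - Psid s) + u s *: adj B2 (p s))) v &
        p t = adj (S (T - t)) (p T) + v].

Definition cost (T alpha : R) (Q QT : 'L(H, 'L(H, R^o)))
    (Psid : R -> H) (PsidT : H) (u : R -> R) (Psi : R -> H) : R :=
  let q y := Q y y in
  let qT y := QT y y in
  alpha * (\int[lebesgue_measure]_(t in `]0, T[) u t) +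
  2^-1 * (\int[lebesgue_measure]_(t in `]0, T[) q (Psi t - Psid t)) +
  2^-1 * qT (Psi T - PsidT).

End Problem.

Section Controls.
Context (R : realType).

Definition admissible (T um uM : R) (u : R -> R) : Prop :=
  lebesgue_measure.-integrable `]0, T[ (EFin \o u) /\
  {ae lebesgue_measure, forall t, `]0, T[%classic t -> um <= u t <= uM}.

Definition weak_minimum (T um uM : R) (F : (R -> R) -> R) (u : R -> R) : Prop :=
  admissible T um uM u /\
  exists2 e : R, 0 < e & forall v : R -> R, admissible T um uM v ->
    ('N[lebesgue_measure]_+oo[EFin \o ((v \- u) \_ `]0, T[%classic)%R] < e%:E)%E ->
    F u <= F v.

End Controls.

(* Main.v *)
From HB Require Import structures.
Require Import Defs.
From mathcomp Require Import all_boot all_order all_algebra.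
From mathcomp Require Import all_classical all_reals all_analysis.
From mathcomp Require Import measurable_realfun ess_sup_inf lra ring.

(** Why the theorem is true.  Where the switching function [Lambda] is positive
and the control stays above its lower bound, the control can be lowered a
little; to first order this lowers the cost, which a weak minimum forbids.

The quantitative form is the expansion [first_variation]: if [w] is bounded
by [1], then
  [F (u + e w) - F u <= e * int w Lambda + C e^2],
with [C] independent of [e].  The difference of the two states solves a linear
mild equation whose source is of order [e] ([state_variation_mild]), so
Gronwall's inequality makes the difference itself of order [e]
([variation_bound]); in the cost only the terms linear in that difference
matter, and [duality] evaluates them.  It pairs the forward mild equation of
the difference with the backward one of the costate: both are integrals of one
kernel over the triangle [s < r], and Fubini's theorem exchanges them.  At a
weak minimum the expansion gives [0 <= int w Lambda] in every direction [w]
that is admissible for small [e] ([weak_minimum_direction]).  Taking for [w]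
minus the indicator of the set where [Lambda] and [u - um] are at least
[1 / n] shows that this set is null; up to a null set, the union over [n] is
the exceptional set ([weak_minimum_negligible]); the other sign is symmetric.

The comparison makes sense only if the perturbed controls have a state.
[mild_state_exists] builds it by Picard iteration in a weighted norm.  This
rests on the continuity of convolutions with the semigroup
([convolution_exists]), itself a consequence of dominated convergence and of
the local boundedness of the semigroup ([semigroup_bounded], by the uniform
boundedness principle), and on the elementary theory of the Bochner integral:
norm inequality, existence for integrable functions, and commutation with
bounded operators. *)

Set Implicit Arguments.
Unset Strict Implicit.
Unset Printing Implicit Defensive.

Import Order.TTheory GRing.Theory Num.Theory.
Import numFieldNormedType.Exports.

Local Open Scope classical_set_scope.
Local Open Scope ring_scope.

(** * Step functions *)

Section StepFunctions.
Context (R : realType).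
Local Notation mu := (@lebesgue_measure R).

Section Ops.
Context (V W : normedModType R).
Implicit Types s : simple_fun V.

Definition sf_zero : simple_fun V :=
  @SimpleFun R V 0 (fun=> set0) (fun=> 0)
    (fun=> measurable0) (fun i => match i with Ordinal _ h =>
      False_ind _ (notF h) end).

Definition sf_add_set (s1 s2 : simple_fun V)
  (i : 'I_(sf_size s1 + sf_size s2)) : set R :=
  match fintype.split i with inl j => sf_set j | inr j => sf_set j end.

Definition sf_add_coef (s1 s2 : simple_fun V)
  (i : 'I_(sf_size s1 + sf_size s2)) : V :=
  match fintype.split i with inl j => sf_coef j | inr j => sf_coef j end.

Lemma sf_add_measurable s1 s2 (i : 'I_(sf_size s1 + sf_size s2)) :
  measurable (sf_add_set i).
Proof. by rewrite /sf_add_set; case: fintype.split => j; exact: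
  (sf_measurable j). Qed.

Lemma sf_add_finite s1 s2 (i : 'I_(sf_size s1 + sf_size s2)) :
  (mu (sf_add_set i) < +oo)%E.
Proof. by rewrite /sf_add_set; case: fintype.split => j; exact:
  (sf_finite j). Qed.

Definition sf_add s1 s2 : simple_fun V :=
  SimpleFun (@sf_add_coef s1 s2) (@sf_add_measurable s1 s2)
    (@sf_add_finite s1 s2).

Lemma sf_add_eval s1 s2 t :
  sf_eval (sf_add s1 s2) t = sf_eval s1 t + sf_eval s2 t.
Proof.
rewrite /sf_eval big_split_ord /=; congr (_ + _); apply: eq_bigr => i _;
  rewrite /sf_add_set /sf_add_coef.
- by rewrite -[lshift _ _]/(unsplit (inl i)) unsplitK.
- by rewrite -[rshift _ _]/(unsplit (inr i)) unsplitK.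
Qed.

Lemma sf_add_integral D s1 s2 :
  sf_integral D (sf_add s1 s2) = sf_integral D s1 + sf_integral D s2.
Proof.
rewrite /sf_integral big_split_ord /=; congr (_ + _); apply: eq_bigr => i _;
  rewrite /sf_add_set /sf_add_coef.
- by rewrite -[lshift _ _]/(unsplit (inl i)) unsplitK.
- by rewrite -[rshift _ _]/(unsplit (inr i)) unsplitK.
Qed.

Definition sf_map (l : {linear V -> W}) s : simple_fun W :=
  SimpleFun (fun i => l (sf_coef i)) (@sf_measurable _ _ s) (@sf_finite _ _ s).

Lemma sf_map_eval l s t : sf_eval (sf_map l s) t = l (sf_eval s t).
Proof.
by rewrite /sf_eval linear_sum; apply: eq_bigr => i _; rewrite linearZ.
Qed.

Lemma sf_map_integral D l s : sf_integral D (sf_map l s) = l (sf_integral D s).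
Proof.
by rewrite /sf_integral linear_sum; apply: eq_bigr => i _; rewrite linearZ.
Qed.

Section Cap.
Context (E : set R) (mE : measurable E).

Lemma sf_cap_measurable s (i : 'I_(sf_size s)) : measurable (sf_set i `&` E).
Proof. by apply: measurableI => //; exact: sf_measurable. Qed.

Lemma sf_cap_finite s (i : 'I_(sf_size s)) : (mu (sf_set i `&` E) < +oo)%E.
Proof.
apply: le_lt_trans (sf_finite i); apply: le_measure; rewrite ?inE //=.
- exact: sf_cap_measurable.
- exact: sf_measurable.
Qed.

Definition sf_cap s : simple_fun V :=
  SimpleFun (@sf_coef _ _ s) (@sf_cap_measurable s) (@sf_cap_finite s).

Lemma sf_cap_eval s t : sf_eval (sf_cap s) t = (\1_E t : R) *: sf_eval s t.
Proof.
rewrite /sf_eval scaler_sumr; apply: eq_bigr => i _ /=.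
by rewrite scalerA indicI /= mulrC.
Qed.

Lemma sf_cap_integral D s : E `<=` D ->
  sf_integral D (sf_cap s) = sf_integral E s.
Proof.
move=> ED; apply: eq_bigr => i _ /=; congr (fine (mu _) *: _).
by rewrite -setIA (setIidl ED).
Qed.
End Cap.

End Ops.

Definition sf_sum (V : normedModType R) (n : nat) (s : nat -> simple_fun V) :=
  \big[@sf_add V/@sf_zero V]_(i < n) s i.

Lemma sf_sum_eval (V : normedModType R) n (s : nat -> simple_fun V) t :
  sf_eval (sf_sum n s) t = \sum_(i < n) sf_eval (s i) t.
Proof.
rewrite /sf_sum; elim/big_rec2: _ => [|i y1 y2 _ <-]; last exact: sf_add_eval.
by rewrite /sf_eval big_ord0.
Qed.

(** Splitting along the last set leaves two step functions with one set less,
to which the induction applies. Vectors carry no sigma-algebra here, so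
measurability is stated after composition with a real function. *)
Lemma measurable_comp_step (V : normedModType R) d (X : measurableType d)
    (D : set X) (g : X -> R) (psi : X -> V -> R) n (A : 'I_n -> set R)
    (c : 'I_n -> V) x :
  measurable D -> measurable_fun D g ->
  (forall x, measurable_fun D (psi ^~ x)) -> (forall i, measurable (A i)) ->
  measurable_fun D
    (fun w => psi w (x + \sum_(i < n) (\1_(A i) (g w) : R) *: c i)).
Proof.
move=> mD mg mpsi; elim: n A c x => [|n IH] A c x mA.
  by apply: eq_measurable_fun (mpsi x) => w _; rewrite big_ord0 addr0.
have mgA : measurable_fun D (fun w => g w \in A ord_max).
  apply: (measurable_fun_bool true) => //.
  rewrite [X in measurable X](_ : _ = D `&` g @^-1` A ord_max).
    exact: mg.
  by apply/seteqP; split => w /= [Dw] Aw; split=> //;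
    [exact: set_mem|exact: mem_set].
have mA' i : measurable (A (widen_ord (leqnSn n) i)) by exact: mA.
apply: (@eq_measurable_fun _ _ _ _ _ (fun w => if g w \in A ord_max then
    psi w ((x + c ord_max) + \sum_(i < n)
      (\1_(A (widen_ord (leqnSn n) i)) (g w) : R)
      *: c (widen_ord (leqnSn n) i))
   else psi w (x + \sum_(i < n) (\1_(A (widen_ord (leqnSn n) i)) (g w) : R)
      *: c (widen_ord (leqnSn n) i)))).
  move=> w _; rewrite big_ord_recr /= [in RHS](indicE _ (A ord_max)); case:
    ifPn => _.
    by rewrite scale1r addrAC addrA.
  by rewrite scale0r addr0.
apply: measurable_fun_if => //; apply: measurable_funS (IH _ _ _ mA') => //;
  exact: subIsetl.
Qed.

Lemma measurable_comp_simple (V : normedModType R) d (X : measurableType d)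
    (D : set X) (g : X -> R) (s : simple_fun V) (psi : X -> V -> R) :
  measurable D -> measurable_fun D g ->
  (forall x, measurable_fun D (psi ^~ x)) ->
  measurable_fun D (fun w => psi w (sf_eval s (g w))).
Proof.
move=> mD mg mpsi.
have := @measurable_comp_step V d X D g psi _ _ (@sf_coef _ _ s) 0 mD mg mpsi
  (@sf_measurable _ _ s).
by apply: eq_measurable_fun => w _; rewrite add0r.
Qed.

Lemma measurable_norm_simple (V : normedModType R) (D : set R)
  (s : simple_fun V) :
  measurable D -> measurable_fun D (fun t => `|sf_eval s t|).
Proof.
move=> mD; apply: (@measurable_comp_simple V _ _ D id s (fun=> Num.norm)) => //.
Qed.

(** The sets of a step function may overlap, so the triangle inequality alone
does not bring the norm inside; the domain is split along one set after the
other until the integrand is constant. *)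
Lemma le_norm_sf_integral (V : normedModType R) (D : set R) (s : simple_fun V) :
  measurable D -> (mu D < +oo)%E ->
  (`|sf_integral D s|%:E <= \int[mu]_(t in D) `|sf_eval s t|%:E)%E.
Proof.
move=> mD fD.
suff H n (A : 'I_n -> set R) (c : 'I_n -> V) x (E : set R) :
    measurable E -> (mu E < +oo)%E -> (forall i, measurable (A i)) ->
    (`|fine (mu E) *: x + \sum_(i < n) fine (mu (A i `&` E)) *: c i|%:E <=
     \int[mu]_(t in E) `|x + \sum_(i < n) (\1_(A i) t : R) *: c i|%:E)%E.
  have := H _ _ (@sf_coef _ _ s) 0 D mD fD (@sf_measurable _ _ s).
  rewrite scaler0 add0r => /le_trans; apply.
  by rewrite le_eqVlt; apply/orP; left; apply/eqP; apply: eq_integral => t _;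
    rewrite add0r.
elim: n A c x E => [|n IH] A c x E mE fE mA.
  rewrite big_ord0 addr0 normrZ EFinM ger0_norm ?fine_ge0//.
  rewrite fineK ?ge0_fin_numE// muleC -integral_cst//.
  by under [in leRHS]eq_integral do rewrite big_ord0 addr0.
set B := A ord_max; have mB : measurable B by exact: mA.
have fin (F : set R) : F `<=` E -> measurable F -> (mu F < +oo)%E.
  by move=> FE mF; apply: le_lt_trans fE; apply: le_measure; rewrite ?inE.
have muB F : measurable F -> F `<=` E ->
   fine (mu F) = fine (mu (F `&` B)) + fine (mu (F `\` B)).
  move=> mF FE; rewrite -fineD; last 2 first.
  - rewrite ge0_fin_numE//; apply: fin; last exact: measurableI.
    by apply: subset_trans FE; exact: subIsetl.
  - rewrite ge0_fin_numE//; apply: fin; last exact: measurableD.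
    by apply: subset_trans FE; exact: subDsetl.
  congr fine; rewrite -measureU//; first by rewrite setUIDK.
  - exact: measurableI.
  - exact: measurableD.
  - by rewrite setIDA setDE -setIA setICA -setIA setICr !setI0.
have mA' i : measurable (A (widen_ord (leqnSn n) i)) by exact: mA.
have mEB : measurable (E `&` B) by exact: measurableI.
have mEDB : measurable (E `\` B) by exact: measurableD.
have IH1 := IH _ (fun i => c (widen_ord (leqnSn n) i)) (x + c ord_max) (E `&` B)
  mEB (fin _ (@subIsetl _ _ _) mEB) mA'.
have IH2 := IH _ (fun i => c (widen_ord (leqnSn n) i)) x (E `\` B)
  mEDB (fin _ (@subDsetl _ _ _) mEDB) mA'.
rewrite -[X in integral _ X _](setUIDK E B) ge0_integral_setU//; last 2 first.
- rewrite setUIDK; apply/measurable_EFinP.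
  exact: (@measurable_comp_step V _ _ E id (fun=> Num.norm)).
- by apply/disj_setPS => t [[_ Bt] [_ /(_ Bt)]].
apply: le_trans; last first.
  apply: leeD.
  - apply: le_trans IH1 _; rewrite le_eqVlt; apply/orP; left; apply/eqP.
    apply: eq_integral => t; rewrite inE => -[_ Bt].
    by rewrite big_ord_recr /= (indicE _ (A ord_max)) mem_set// scale1r addrAC
      addrA.
  - apply: le_trans IH2 _; rewrite le_eqVlt; apply/orP; left; apply/eqP.
    apply: eq_integral => t; rewrite inE => -[_ Bt].
    by rewrite big_ord_recr /= (indicE _ (A ord_max)) memNset// scale0r addr0.
rewrite -EFinD lee_fin; apply: le_trans (ler_normD _ _).
rewrite le_eqVlt; apply/orP; left; apply/eqP; congr `|_|.
rewrite addrACA -big_split /= scalerDr.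
under [in RHS]eq_bigr => i _.
  rewrite -scalerDl setIA setIDA -muB; [|exact: measurableI|exact: subIsetr];
    over.
rewrite (muB _ mE)// big_ord_recr /= scalerDl (setIC B) -!addrA; congr (_ + _).
by rewrite [RHS]addrCA; congr (_ + _); rewrite addrC.
Qed.
End StepFunctions.

(** * Strong measurability *)

Lemma cvge0_epsP (R : realType) (u : nat -> \bar R) : (forall n, 0 <= u n)%E ->
  u n @[n --> \oo] --> 0%E <->
  (forall e : R, 0 < e -> \forall n \near \oo, (u n <= e%:E)%E).
Proof.
move=> u0; split.
  move=> /fine_cvgP[ufin /cvgr0Pnorm_le u_0] e e0.
  near=> n; have un : u n \is a fin_num by near: n.
  have : `|fine (u n)| <= e by near: n; exact: u_0.
  by move=> /(le_trans (ler_norm _)); rewrite -lee_fin fineK.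
move=> ue; apply/fine_cvgP; split.
  by near=> n; rewrite ge0_fin_numE// (@le_lt_trans _ _ 1%:E) ?ltry//; near: n;
    exact: ue.
apply/cvgr0Pnorm_le => e e0; near=> n.
have une : (u n <= e%:E)%E by near: n; exact: ue.
rewrite /= ger0_norm ?fine_ge0// -lee_fin fineK//.
by rewrite ge0_fin_numE// (le_lt_trans une)// ltry.
Unshelve. all: by end_near. Qed.

Section StrongMeasurability.
Context (R : realType).
Local Notation mu := (@lebesgue_measure R).

Lemma strongly_measurable_subset (V : normedModType R) (D E : set R)
  (f : R -> V) :
  E `<=` D -> strongly_measurable D f -> strongly_measurable E f.
Proof. by move=> ED [s sf]; exists s => t /ED; exact: sf. Qed.

Lemma strongly_measurable_ext (V : normedModType R) (D : set R) (f g : R -> V) :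
  (forall t, D t -> f t = g t) -> strongly_measurable D f ->
    strongly_measurable D g.
Proof. by move=> fg [s sf]; exists s => t Dt; rewrite -fg//; exact: sf. Qed.

Lemma strongly_measurable_simple (V : normedModType R) (D : set R)
  (s : simple_fun V) :
  strongly_measurable D (sf_eval s).
Proof. by exists (fun=> s) => t _; exact: cvg_cst. Qed.

Lemma strongly_measurable_add (V : normedModType R) (D : set R) (f g : R -> V) :
  strongly_measurable D f -> strongly_measurable D g ->
  strongly_measurable D (fun t => f t + g t).
Proof.
move=> [s sf] [s' sg]; exists (fun n => sf_add (s n) (s' n)) => t Dt.
under eq_fun do rewrite sf_add_eval.
by apply: cvgD; [exact: sf|exact: sg].
Qed.

Lemma strongly_measurable_map (V W : normedModType R) (l : {linear V -> W})
  (D : set R) (f : R -> V) :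
  continuous l -> strongly_measurable D f ->
    strongly_measurable D (fun t => l (f t)).
Proof.
move=> cl [s sf]; exists (fun n => sf_map l (s n)) => t Dt.
under eq_fun do rewrite sf_map_eval.
by apply: (continuous_cvg _ (cl _)); exact: sf.
Qed.

Lemma strongly_measurable_opp (V : normedModType R) (D : set R) (f : R -> V) :
  strongly_measurable D f -> strongly_measurable D (fun t => - f t).
Proof. by apply: (@strongly_measurable_map V V -%R); exact: opp_continuous. Qed.

Lemma strongly_measurable_sub (V : normedModType R) (D : set R) (f g : R -> V) :
  strongly_measurable D f -> strongly_measurable D g ->
  strongly_measurable D (fun t => f t - g t).
Proof. by move=> mf mg; apply: strongly_measurable_add => //; exact:
  strongly_measurable_opp. Qed.

Lemma strongly_measurable_patch (V : normedModType R) (D E : set R)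
  (f : R -> V) :
  measurable E -> strongly_measurable E f ->
  strongly_measurable D (fun t => (\1_E t : R) *: f t).
Proof.
move=> mE [s sf]; exists (fun n => sf_cap mE (s n)) => t _.
under eq_fun do rewrite sf_cap_eval.
rewrite indicE; have [/set_mem Et|_] := boolP (t \in E).
  by rewrite scale1r; under eq_fun do rewrite scale1r; exact: sf.
by rewrite scale0r; under eq_fun do rewrite scale0r; exact: cvg_cst.
Qed.

Lemma measurable_comp_strongly_measurable (V : normedModType R) (D : set R)
  (f : R -> V)
    d (X : measurableType d) (E : set X) (g : X -> R) (psi : X -> V -> R) :
  strongly_measurable D f -> measurable E -> measurable_fun E g ->
  (forall w, E w -> D (g w)) ->
  (forall x, measurable_fun E (psi ^~ x)) ->
  (forall w, E w -> continuous (psi w)) ->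
  measurable_fun E (fun w => psi w (f (g w))).
Proof.
move=> [s sf] mE mg ED mpsi cpsi.
apply: (@measurable_realfun.measurable_fun_cvg _ _ _ _
   (fun n w => psi w (sf_eval (s n) (g w)))).
  by move=> n; exact: measurable_comp_simple.
by move=> w Ew; apply: (continuous_cvg _ (cpsi _ Ew _)); apply: sf; exact: ED.
Qed.

Lemma measurable_norm_strongly_measurable (V : normedModType R) (D : set R)
  (f : R -> V) :
  measurable D -> strongly_measurable D f -> measurable_fun D (fun t => `|f t|).
Proof.
move=> mD mf.
apply: (@measurable_comp_strongly_measurable V D f _ _ D id (fun=> Num.norm)) =>
  //.
by move=> w _; exact: norm_continuous.
Qed.

Lemma measurable_real_strongly_measurable (D : set R) (f : R -> R^o) :
  measurable D -> strongly_measurable D f -> measurable_fun D (f : R -> R).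
Proof.
move=> mD mf; apply:
  (@measurable_comp_strongly_measurable R^o D f _ _ D id (fun=> id)) => //.
by move=> w _ x; exact: cvg_id.
Qed.

(** At each stage the time in the operator is replaced by the grid point just
below it; only finitely many operators then occur, so step functions are mapped
to step functions. *)
Lemma strongly_measurable_op_family (V W : normedModType R) (D : set R)
  (Phi : R -> {linear V -> W}) (f : R -> V) :
  (forall t, D t -> 0 <= t) ->
  continuous (fun z : R * V => Phi z.1 z.2) ->
  strongly_measurable D f -> strongly_measurable D (fun t => Phi t (f t)).
Proof.
move=> D0 cPhi [s sf].
pose N n : R := n.+1%:R.
pose C n k := `[k%:R / N n, k.+1%:R / N n[%classic.
have mC n k : measurable (C n k) by exact: measurable_itv.
(* the number of cells is squared so that the grid reaches any given time *)
exists (fun n => sf_sum (n.+1 * n.+1)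
  (fun k => sf_cap (mC n k) (sf_map (Phi (k%:R / N n)) (s n)))) => t Dt.
pose K n := Num.truncn (t * N n).
have N0 n : 0 < N n by rewrite ltr0n.
have t0 : 0 <= t by exact: D0.
have tN0 n : 0 <= t * N n by rewrite mulr_ge0// ltW.
have CK n k : (t \in C n k) = (k == K n).
  rewrite eq_sym /K truncn_eq//.
  apply/idP/idP => [/set_mem|tk]; last apply/mem_set.
    by rewrite /C /= in_itv /= ler_pdivrMr// ltr_pdivlMr.
  by rewrite /C /= in_itv /= ler_pdivrMr// ltr_pdivlMr.
have cK : (K n)%:R / N n @[n --> \oo] --> t.
  apply/cvgrPdist_le => e e0; near=> n.
  have /andP[h1 h2] := truncn_itv (tN0 n).
  have ne : (N n)^-1 <= e.
    near: n; have /cvgr0Pnorm_le/(_ _ e0) := @cvg_harmonic R.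
    by apply: filterS => n /=; rewrite ger0_norm.
  apply: le_trans ne; rewrite -[t](mulfK (lt0r_neq0 (N0 n))) -mulrBl.
  rewrite normrM [`|(N n)^-1|]ger0_norm; last by rewrite invr_ge0 ltW.
  rewrite ger_pMl ?invr_gt0// ger0_norm ?subr_ge0//.
  by rewrite lerBlDl natr1 ltW.
have H : Phi ((K n)%:R / N n) (sf_eval (s n) t) @[n --> \oo] --> Phi t (f t).
  exact: (cvg_comp _ _ (cvg_pair cK (sf _ Dt)) (cPhi (t, f t))).
apply: cvg_trans H; apply: near_eq_cvg; near=> n => /=.
rewrite sf_sum_eval.
have KN : (K n < n.+1 * n.+1)%N.
  rewrite -(ltr_nat R); apply:
    le_lt_trans (proj1 (andP (truncn_itv (tN0 n)))) _.
  rewrite natrM ltr_pM2r// (@lt_trans _ _ n%:R) ?ltr_nat//.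
  by near: n; exact: nbhs_infty_gtr.
rewrite (bigD1 (Ordinal KN)) //= big1 ?addr0.
  by rewrite sf_cap_eval indicE CK eqxx scale1r sf_map_eval.
move=> i; rewrite -val_eqE /= => iK.
by rewrite sf_cap_eval indicE CK (negbTE iK) scale0r.
Unshelve. all: by end_near. Qed.

End StrongMeasurability.

(** * The Bochner integral *)

Section BochnerIntegral.
Context (R : realType).
Local Notation mu := (@lebesgue_measure R).

Lemma le_integral_normD (V : normedModType R) (D : set R) (f g : R -> V) :
  measurable D -> strongly_measurable D f -> strongly_measurable D g ->
  (\int[mu]_(t in D) `|f t + g t|%:E <=
   \int[mu]_(t in D) `|f t|%:E + \int[mu]_(t in D) `|g t|%:E)%E.
Proof.
move=> mD mf mg; rewrite -ge0_integralD//; last 2 first.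
- by apply/measurable_EFinP; exact: measurable_norm_strongly_measurable.
- by apply/measurable_EFinP; exact: measurable_norm_strongly_measurable.
apply: ge0_le_integral => //.
- by apply/measurable_EFinP; apply: measurable_norm_strongly_measurable => //;
    exact: strongly_measurable_add.
- by apply: emeasurable_funD; apply/measurable_EFinP; exact:
    measurable_norm_strongly_measurable.
- by move=> t _; rewrite -EFinD lee_fin ler_normD.
Qed.

Lemma integral_normN (V : normedModType R) (D : set R) (f : R -> V) :
  (\int[mu]_(t in D) `|- f t|%:E = \int[mu]_(t in D) `|f t|%:E)%E.
Proof. by apply: eq_integral => t _; rewrite normrN. Qed.

Lemma bochner_integral_ext (V : normedModType R) (D : set R) (f g : R -> V) v :
  (forall t, D t -> f t = g t) ->
  has_bochner_integral D f v -> has_bochner_integral D g v.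
Proof.
move=> fg [mf [s [s0 sv]]]; split; first exact: strongly_measurable_ext mf.
exists s; split=> //; apply: cvg_trans s0; apply: near_eq_cvg.
by apply: nearW => n; apply: eq_integral => t; rewrite inE => /fg ->.
Qed.

Lemma bochner_integral_approx (V : normedModType R) (D : set R)
  (f : R -> V) v (e : R) :
  0 < e -> has_bochner_integral D f v -> exists s : simple_fun V,
    (\int[mu]_(t in D) `|f t - sf_eval s t|%:E <= e%:E)%E /\
    `|v - sf_integral D s| <= e.
Proof.
move=> e0 [_ [s [/cvge0_epsP s0 /cvgrPdist_le sv]]].
have h0 n : (0 <= \int[mu]_(t in D) `|f t - sf_eval (s n) t|%:E)%E.
  by apply: integral_ge0 => t _; rewrite lee_fin.
by have [n h] := filter_ex (filterI (s0 h0 _ e0) (sv _ e0)); exists (s n).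
Qed.

Section FiniteMeasure.
Context (D : set R) (mD : measurable D) (fD : (mu D < +oo)%E).

Lemma le_norm_bochner_integral (V : normedModType R) (f : R -> V) v :
  has_bochner_integral D f v -> (`|v|%:E <= \int[mu]_(t in D) `|f t|%:E)%E.
Proof.
move=> hf; have mf := hf.1.
apply/lee_addgt0Pr => e e0; have e20 : 0 < e / 2 by rewrite divr_gt0.
have [s [h1 h2]] := bochner_integral_approx e20 hf.
rewrite [e in leRHS](splitr e) [in leRHS]EFinD addeA.
apply: (@le_trans _ _ (`|sf_integral D s|%:E + (e / 2)%:E)%E).
  rewrite -EFinD lee_fin -lerBlDl; apply: le_trans h2.
  exact: lerB_dist.
rewrite leeD2r//; apply: le_trans (le_norm_sf_integral _ mD fD) _.
have -> : (\int[mu]_(t in D) `|sf_eval s t|%:E =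
    \int[mu]_(t in D) `|f t + - (f t - sf_eval s t)|%:E)%E.
  by apply: eq_integral => t _; rewrite opprB addrC subrK.
have msub : strongly_measurable D (fun t => f t - sf_eval s t).
  by apply: strongly_measurable_sub => //; exact: strongly_measurable_simple.
apply: le_trans (le_integral_normD mD mf (strongly_measurable_opp msub)) _.
by rewrite integral_normN leeD2l.
Qed.

Lemma bochner_integral_add (V : normedModType R) (f g : R -> V) v w :
  has_bochner_integral D f v -> has_bochner_integral D g w ->
  has_bochner_integral D (fun t => f t + g t) (v + w).
Proof.
move=> [mf [s [s0 sv]]] [mg [s' [s'0 sw]]]; split; first exact:
  strongly_measurable_add.
exists (fun n => sf_add (s n) (s' n)); split; last first.
  by under eq_fun do rewrite sf_add_integral; exact: cvgD.
have h : (\int[mu]_(t in D) `|f t - sf_eval (s n) t|%:E +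
    \int[mu]_(t in D) `|g t - sf_eval (s' n) t|%:E)%E @[n --> \oo] --> 0%E.
  by rewrite -[X in _ --> X]adde0; apply: cvgeD.
apply: squeeze_cvge (cvg_cst 0%E) h.
apply: nearW => n; rewrite integral_ge0//=.
under eq_integral do rewrite sf_add_eval opprD addrACA.
by apply: le_integral_normD => //; apply: strongly_measurable_sub => //; exact:
  strongly_measurable_simple.
Qed.

Lemma bochner_integral_map (V W : normedModType R) (l : {linear V -> W})
  (f : R -> V) v :
  continuous l -> has_bochner_integral D f v ->
  has_bochner_integral D (fun t => l (f t)) (l v).
Proof.
move=> cl [mf [s [s0 sv]]]; split; first exact: strongly_measurable_map.
exists (fun n => sf_map l (s n)); split; last first.
  by under eq_fun do rewrite sf_map_integral; exact: (continuous_cvg _ (cl _)).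
have /linear_boundedP/pinfty_ex_gt0[M M0 lM] : bounded_near l (nbhs (0 : V)).
  by apply/linear_bounded_continuous.
have h : (M%:E * \int[mu]_(t in D) `|f t - sf_eval (s n) t|%:E)%E
    @[n --> \oo] --> 0%E.
  by rewrite -[X in _ --> X](mule0 M%:E); apply: cvgeZl.
apply: squeeze_cvge (cvg_cst 0%E) h.
apply: nearW => n; rewrite integral_ge0//=.
have mfs : strongly_measurable D (fun t => f t - sf_eval (s n) t).
  by apply: strongly_measurable_sub => //; exact: strongly_measurable_simple.
rewrite -ge0_integralZl//; last 2 first.
- by apply/measurable_EFinP; exact: measurable_norm_strongly_measurable.
- by rewrite lee_fin ltW.
under [leLHS]eq_integral do rewrite sf_map_eval -linearB.
apply: ge0_le_integral => //.
- by apply/measurable_EFinP; apply: measurable_norm_strongly_measurable => //;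
    exact: strongly_measurable_map.
- apply: measurable_funeM; apply/measurable_EFinP; exact:
    measurable_norm_strongly_measurable.
- by move=> t _; rewrite -EFinM lee_fin lM.
Qed.

Lemma bochner_integral_opp (V : normedModType R) (f : R -> V) v :
  has_bochner_integral D f v -> has_bochner_integral D (fun t => - f t) (- v).
Proof. by apply: (@bochner_integral_map V V -%R); exact: opp_continuous. Qed.

Lemma bochner_integral_sub (V : normedModType R) (f g : R -> V) v w :
  has_bochner_integral D f v -> has_bochner_integral D g w ->
  has_bochner_integral D (fun t => f t - g t) (v - w).
Proof. by move=> hf hg; apply: bochner_integral_add => //; exact:
  bochner_integral_opp. Qed.

Lemma integral_sf_norm_lty (V : normedModType R) (s : simple_fun V) :
  (\int[mu]_(t in D) `|sf_eval s t|%:E < +oo)%E.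
Proof.
pose M := \sum_(i < sf_size s) `|@sf_coef _ _ s i|.
apply: (@le_lt_trans _ _ (\int[mu]_(t in D) M%:E)%E).
  apply: ge0_le_integral => //.
    by apply/measurable_EFinP; exact: measurable_norm_simple.
  move=> t _; rewrite lee_fin; apply: le_trans (ler_norm_sum _ _ _) _.
  apply: ler_sum => i _; rewrite normrZ ler_piMl// indicE.
  by case: (_ \in _); rewrite ?normr1 ?normr0.
rewrite integral_cst// lte_mul_pinfty//.
by rewrite lee_fin sumr_ge0.
Qed.

Lemma bochner_integral_L1 (V : normedModType R) (f : R -> V) v :
  has_bochner_integral D f v -> bochner_L1 D f.
Proof.
move=> hf; have mf := hf.1; split=> //.
have [s [h _]] := bochner_integral_approx ltr01 hf.
have -> : (\int[mu]_(t in D) `|f t|%:E =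
    \int[mu]_(t in D) `|(f t - sf_eval s t) + sf_eval s t|%:E)%E.
  by apply: eq_integral => t _; rewrite subrK.
apply: le_lt_trans (le_integral_normD mD _ _) _.
- by apply: strongly_measurable_sub => //; exact: strongly_measurable_simple.
- exact: strongly_measurable_simple.
- by rewrite lte_add_pinfty ?integral_sf_norm_lty// (le_lt_trans h)// ltry.
Qed.

Lemma integral_sf_real (s : simple_fun R^o) :
  (\int[mu]_(t in D) (sf_eval s t)%:E = (sf_integral D s)%:E)%E.
Proof.
have fsD i : (mu (@sf_set _ _ s i `&` D) < +oo)%E.
  apply: le_lt_trans fD; apply: le_measure; rewrite ?inE//.
  by apply: measurableI => //; exact: sf_measurable.
rewrite /sf_eval; under eq_integral do rewrite -sumEFin.
have ic i : mu.-integrable D (fun t => (\1_(@sf_set _ _ s i) t)%:E).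
  apply/integrableP; split.
    by apply/measurable_EFinP; apply: measurable_indic; exact: sf_measurable.
  under eq_integral do rewrite /= ger0_norm//.
  by rewrite integral_indic ?fsD//; exact: sf_measurable.
rewrite integral_sum//; last first.
  move=> i; rewrite /=; under eq_fun do rewrite EFinM.
  by apply: integrableZr.
rewrite /sf_integral -sumEFin; apply: eq_bigr => i _.
under eq_integral do rewrite EFinM.
rewrite integralZr// integral_indic//; last exact: sf_measurable.
by rewrite EFinM fineK// ge0_fin_numE.
Qed.

(** After a functional has been applied to a vector integral, this gives access
to the order and to Fubini's theorem. *)
Lemma bochner_integral_real (f : R -> R^o) v : has_bochner_integral D f v ->
  mu.-integrable D (EFin \o (f : R -> R)) /\ v = \int[mu]_(t in D) f t.
Proof.
move=> hf; have [mf Lf] := bochner_integral_L1 hf.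
have intf : mu.-integrable D (EFin \o (f : R -> R)).
  apply/integrableP; split; first by apply/measurable_EFinP; exact:
    measurable_real_strongly_measurable.
  exact: Lf.
split=> //.
apply/eqP; rewrite -subr_eq0 -normr_le0; apply/ler_addgt0Pr => e e0.
rewrite add0r; have e20 : 0 < e / 2 by rewrite divr_gt0.
have [s [h1 h2]] := bochner_integral_approx e20 hf.
rewrite (splitr e) -[v](subrK (sf_integral D s)) -addrA.
apply: le_trans (ler_normD _ _) (lerD h2 _).
have ints : mu.-integrable D (EFin \o (sf_eval s : R -> R)).
  apply/integrableP; split; last exact: integral_sf_norm_lty.
  by apply/measurable_EFinP; apply: measurable_real_strongly_measurable => //;
    exact: strongly_measurable_simple.
have -> : sf_integral D s = \int[mu]_(t in D) sf_eval s t.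
  by rewrite /Rintegral integral_sf_real.
rewrite distrC -RintegralB// -lee_fin.
have intfs : mu.-integrable D (EFin \o (fun t => f t - sf_eval s t : R)).
  exact: (@integrableB _ _ _ mu D mD _ _ intf ints).
apply: le_trans h1; rewrite EFin_normr_Rintegral//.
by apply: le_trans (le_abse_integral _ _ _) _ => //; case/integrableP : intfs.
Qed.

End FiniteMeasure.

(** Truncating the approximating step functions to where they are at most twice
the target makes dominated convergence applicable; completeness of the space
then provides the limit of their integrals. *)
Lemma bochner_integral_exists (V : completeNormedModType R) (D : set R)
  (f : R -> V) :
  measurable D -> (mu D < +oo)%E -> bochner_L1 D f ->
  exists v, has_bochner_integral D f v.
Proof.
move=> mD fD [mf Lf]; have [s sf] := mf.
have mnf := measurable_norm_strongly_measurable mD mf.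
pose E n := D `&` [set t | `|sf_eval (s n) t| <= 2 * `|f t| ].
have mE n : measurable (E n).
  rewrite /E; apply: measurable_fun_le => //; first exact:
    measurable_norm_simple.
  exact: measurable_funM.
pose s' n := sf_cap (mE n) (s n).
have s'D n t : D t -> `|f t - sf_eval (s' n) t| <= 3 * `|f t|.
  move=> Dt; rewrite sf_cap_eval indicE;
    have [/set_mem[_ /= h]|_] := boolP (t \in E n).
    rewrite scale1r; apply: le_trans (ler_normB _ _) _.
    by apply: le_trans (lerD (lexx _) h) _; lra.
  by rewrite scale0r subr0 ler_peMl// ler1n.
(* where [f] vanishes the truncation is [0]; elsewhere it ends up inactive *)
have s'f t : D t -> sf_eval (s' n) t @[n --> \oo] --> f t.
  move=> Dt; have [ft0|ft0] := eqVneq (f t) 0.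
    rewrite ft0 [X in X @ _ --> _](_ : _ = fun=> 0); first exact: cvg_cst.
    apply/funext => n; apply/eqP; rewrite -normr_le0.
    have := s'D n _ Dt; rewrite ft0 sub0r normrN normr0 mulr0 => /le_trans;
      exact.
  apply: cvg_trans (sf _ Dt); apply: near_eq_cvg.
  have ft1 : `|f t| < 2 * `|f t| by rewrite ltr_pMl ?normr_gt0// ltr1n.
  have /cvgr_norm_lt/(_ _ ft1) := sf _ Dt.
  apply: filterS => n nt; rewrite sf_cap_eval indicE mem_set ?scale1r//.
  by split=> //=; exact: ltW.
have ms' n : strongly_measurable D (fun t => f t - sf_eval (s' n) t).
  by apply: strongly_measurable_sub => //; exact: strongly_measurable_simple.
have e0 : (\int[mu]_(t in D) `|f t - sf_eval (s' n) t|%:E)%E @[n --> \oo] -->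
  0%E.
  have [] := @dominated_convergence _ _ _ mu D mD
    (fun n t => `|f t - sf_eval (s' n) t|%:E) (cst 0%E)
      (fun t => (3 * `|f t|)%:E).
  - by move=> n; apply/measurable_EFinP; exact:
      measurable_norm_strongly_measurable.
  - exact: measurable_cst.
  - apply: aeW => t Dt; apply: cvg_EFin; first exact: nearW.
    have h : f t - sf_eval (s' n) t @[n --> \oo] --> f t - f t.
      by apply: cvgB; [exact: cvg_cst|exact: s'f].
    by move/cvg_norm : h; rewrite subrr normr0.
  - under eq_fun do rewrite EFinM; apply: integrableZl => //.
    apply/integrableP; split; first exact/measurable_EFinP.
    by under eq_integral do rewrite /= normr_id.
  - by apply: aeW => t n Dt /=; rewrite normr_id lee_fin s'D.
  - by rewrite integral0.
have : cvg (sf_integral D (s' n) @[n --> \oo]).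
  apply/cauchy_cvgP/cauchy_exP => e e_gt0.
  have h0 n : (0 <= \int[mu]_(t in D) `|f t - sf_eval (s' n) t|%:E)%E.
    by apply: integral_ge0 => t _; rewrite lee_fin.
  have e30 : 0 < e / 3 by rewrite divr_gt0.
  have [N _ eN] := (cvge0_epsP h0).1 e0 _ e30.
  exists (sf_integral D (s' N)); exists N => // n /= Nn.
  rewrite -ball_normE /ball_ /=.
  have mN := ms' N; have mn := ms' n.
  have hN : (\int[mu]_(t in D) `|f t - sf_eval (s' N) t|%:E <= (e / 3)%:E)%E.
    exact: (eN N (leqnn N)).
  have hn : (\int[mu]_(t in D) `|f t - sf_eval (s' n) t|%:E <= (e / 3)%:E)%E.
    exact: (eN n Nn).
  pose d := sf_add (s' N) (sf_map (-%R : {linear V -> V}) (s' n)).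
  have -> : sf_integral D (s' N) - sf_integral D (s' n) = sf_integral D d.
    by rewrite sf_add_integral sf_map_integral.
  apply: (@le_lt_trans _ _ (e / 3 + e / 3)); last by lra.
  rewrite -lee_fin; apply: le_trans (le_norm_sf_integral _ mD fD) _.
  rewrite EFinD; apply: le_trans (leeD hn hN).
  rewrite -[X in (_ <= _ + X)%E]integral_normN.
  apply: le_trans (le_integral_normD mD mn (strongly_measurable_opp mN)).
  under [leRHS]eq_integral do rewrite opprB addrC addrA subrK.
  rewrite le_eqVlt; apply/orP; left; apply/eqP; apply: eq_integral => t _.
  by rewrite sf_add_eval sf_map_eval.
move=> /cvg_ex[v s'v]; exists v; split=> //; exists s'; split=> //.
Qed.

(** Brings integrals over different time intervals to a common one, where they
can be subtracted. *)
Lemma bochner_integral_patch (V : normedModType R) (D E : set R)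
  (f : R -> V) v :
  measurable D -> measurable E -> E `<=` D -> has_bochner_integral E f v ->
  has_bochner_integral D (fun t => (\1_E t : R) *: f t) v.
Proof.
move=> mD mE ED [mf [s [s0 sv]]]; split; first exact: strongly_measurable_patch.
exists (fun n => sf_cap mE (s n)); split; last first.
  by under eq_fun do rewrite sf_cap_integral//.
apply: cvg_trans s0; apply: near_eq_cvg; apply: nearW => n.
rewrite [in LHS]integral_mkcond [in RHS]integral_mkcond; apply: eq_integral =>
  t _.
rewrite /patch sf_cap_eval -scalerBr indicE; have [tE|tE] := boolP (t \in E).
  by rewrite mem_set ?scale1r//; apply: ED; exact: set_mem.
by rewrite scale0r normr0; case: ifP.
Qed.

Lemma bochner_integral_unique (V : normedModType R) (D : set R)
  (f : R -> V) v w :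
  measurable D -> (mu D < +oo)%E ->
  has_bochner_integral D f v -> has_bochner_integral D f w -> v = w.
Proof.
move=> mD fD hv hw; apply/eqP; rewrite -subr_eq0 -normr_le0 -lee_fin.
apply: le_trans (le_norm_bochner_integral mD fD (bochner_integral_sub mD hv hw))
  _.
by under eq_integral do rewrite subrr normr0; rewrite integral0.
Qed.

End BochnerIntegral.

(** * Strongly continuous semigroups *)

Section Semigroup.
Context (R : realType) (H : completeNormedModType R) (S : R -> 'L(H, H)).
Hypothesis C0 : C0_semigroup S.

Lemma semigroup_near0 y (e : R) : 0 < e ->
  exists2 d : R, 0 < d & forall h, 0 <= h < d -> `|S h y - y| < e.
Proof.
move=> e0; have [S0 _ Sc] := C0.
have /cvgrPdist_lt/(_ _ e0) := Sc y.
rewrite near_withinE => /nbhs_ballP[d /= d0 dS]; exists d => // h /andP[h0 hd].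
have [->|hn0] := eqVneq h 0; first by rewrite S0 subrr normr0.
rewrite distrC; apply: dS; last by rewrite lt_neqAle eq_sym hn0.
by rewrite -ball_normE /ball_ /= sub0r normrN ger0_norm.
Qed.

(** By the uniform boundedness principle: otherwise some operators at times
tending to [0] would have unbounded norms, although each orbit converges along
these times. *)
Lemma semigroup_bounded0 : exists d M : R,
  [/\ 0 < d, 1 <= M & forall t y, 0 <= t <= d -> `|S t y| <= M * `|y|].
Proof.
have [S0 _ _] := C0.
apply/not_existsP => nB.
have /choice[t tP] : forall n : nat, exists t : R, 0 <= t <= n.+1%:R^-1 /\
    exists y, n.+1%:R * `|y| < `|S t y|.
  move=> n; apply: contrapT => /forallNP nt.
  apply: (nB n.+1%:R^-1); exists n.+1%:R; split;
    [by rewrite invr_gt0 ltr0n|by rewrite ler1n|].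
  move=> s y sn; rewrite leNgt; apply/negP => h; apply: (nt s); split=> //.
  by exists y.
pose F := [set g : H -> H | exists n, g = S (t n)].
have Fb : forall g, F g -> bounded_fun_norm g /\ linear g.
  move=> _ [n ->]; split; last exact: bop_is_linear.
  move=> r; exists (opnorm (S (t n)) * r) => x xr.
  by rewrite (le_trans (opnorm_ler _ _))// ler_wpM2l// opnorm_ge0.
have Fp : pointwise_bounded F.
  move=> x; have [d d0 dS] := semigroup_near0 x ltr01.
  have : S (t n) x @[n --> \oo] --> x.
    apply/cvgrPdist_lt => e e0; have [c c0 cS] := semigroup_near0 x e0.
    near=> n; rewrite distrC; apply: cS; have [/andP[t0 tn] _] := tP n.
    rewrite t0 (le_lt_trans tn)//.
    near: n; have /cvgr0Pnorm_lt/(_ _ c0) := @cvg_harmonic R.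
    by apply: filterS => n /=; rewrite ger0_norm.
  move=> /cvgP/cvg_seq_bounded[M [_ /(_ (M + 1))]] MS.
  exists (M + 1) => _ [n ->]; apply: MS => //.
  by rewrite ltrDl.
have [M MF] := Banach_Steinhauss Fb Fp 1.
pose n := Num.truncn M.
have [_ [y hy]] := tP n.
have y0 : 0 < `|y|.
  rewrite normr_gt0; apply/eqP => y0; move: hy.
  by rewrite y0 linear0 !normr0 mulr0 ltxx.
have := MF (S (t n)) (ex_intro _ n erefl) (`|y|^-1 *: y).
rewrite linearZ /= !normrZ normfV normr_id mulVf ?gt_eqF// => /(_ (lexx _)).
rewrite mulrC ler_pdivrMr// => /(lt_le_trans hy).
rewrite ltr_pM2r// ltNge => /negP; apply.
by apply: ltW; exact: truncnS_gt.
Unshelve. all: by end_near. Qed.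

Lemma semigroup_bounded (N : R) : exists2 M : R, 0 < M &
  forall t y, 0 <= t <= N -> `|S t y| <= M * `|y|.
Proof.
have [_ SD _] := C0.
have [d [M [d0 M1 dM]]] := semigroup_bounded0.
have M0 : 0 < M by exact: lt_le_trans M1.
have key k t y : 0 <= t <= k.+1%:R * d -> `|S t y| <= M ^+ k.+1 * `|y|.
  elim: k t y => [|k IH] t y; first by rewrite mul1r expr1; exact: dM.
  move=> /andP[t0 tk]; have [td|td] := leP t d.
    apply: le_trans (dM _ _ _) _; first by rewrite t0.
    rewrite ler_wpM2r// exprS ler_peMr ?(ltW M0)// exprn_ege1//.
  rewrite -[t](subrK d) addrC SD; [|exact: ltW|by rewrite subr_ge0 ltW].
  apply: le_trans (dM _ _ _) _; first by rewrite lexx (ltW d0).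
  rewrite exprS -mulrA ler_pM2l// IH// subr_ge0 ltW//=.
  by rewrite lerBlDr -[X in _ + X]mul1r -mulrDl natr1.
pose k := Num.truncn (N / d).
exists (M ^+ k.+1); first exact: exprn_gt0.
move=> t y /andP[t0 tN]; apply: key; rewrite t0 (le_trans tN)//.
by rewrite -ler_pdivrMr// ltW// truncnS_gt.
Qed.

(** Orbits are continuous, the operators are not; the local bound on their
norms makes up for the moving vector. Freezing the semigroup at negative times
avoids all side conditions on the time. *)
Lemma semigroup_jointly_continuous :
  continuous (fun z : R * H => S (Num.max z.1 0) z.2).
Proof.
have [_ SD _] := C0.
move=> [t0 x0]; have [M M0 SM] := semigroup_bounded (`|t0| + 1).
have diff s t y : 0 <= s <= `|t0| + 1 -> 0 <= t <= `|t0| + 1 -> s <= t ->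
    `|S t y - S s y| <= M * `|S (t - s) y - y|.
  move=> sN tN st; rewrite -[t in S t](subrK s) [t - s + s]addrC SD ?subr_ge0//;
    last first.
    by case/andP: sN.
  by rewrite -(linearB (S s)) SM.
apply/cvgrPdist_lt => e e0 /=.
have e2 : 0 < e / 2 / M by rewrite !divr_gt0.
have [d d0 dS] := semigroup_near0 x0 e2.
have maxd t : `|Num.max t 0 - Num.max t0 0| <= `|t - t0|.
  have h1 := ler_norm (t - t0); have h2 := ler_norm (t0 - t).
  rewrite distrC in h2; have [t_0|t_0] := leP t 0; have [t0_0|t0_0] := leP t0 0.
  - by rewrite subrr normr0.
  - by rewrite sub0r normrN gtr0_norm//; lra.
  - by rewrite subr0 gtr0_norm//; lra.
  - by [].
have d1 : 0 < Num.min d 1 by rewrite lt_min d0 ltr01.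
have /cvgrPdist_lt/(_ _ d1) c1 : z.1 @[z --> (t0, x0)] --> t0 by exact: cvg_fst.
have /cvgrPdist_lt/(_ _ e2) c2 : z.2 @[z --> (t0, x0)] --> x0 by exact: cvg_snd.
near=> z.
have z1 : `|t0 - z.1| < Num.min d 1.
  by near: z; exact: c1.
have z2 : `|x0 - z.2| < e / 2 / M.
  by near: z; exact: c2.
set a := Num.max t0 0; set b := Num.max z.1 0.
have a0 : 0 <= a by rewrite le_max lexx orbT.
have b0 : 0 <= b by rewrite le_max lexx orbT.
have ab : `|b - a| < Num.min d 1 by apply: le_lt_trans (maxd _) _;
  rewrite distrC.
have aN : a <= `|t0| by rewrite ge_max normr_ge0 ler_norm.
have bN : b <= `|t0| + 1.
  have := ler_norm (b - a); have : `|b - a| < 1 by move: ab; rewrite lt_min =>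
    /andP[].
  lra.
have aN1 : 0 <= a <= `|t0| + 1 by rewrite a0 (le_trans aN)// lerDl.
have bN1 : 0 <= b <= `|t0| + 1 by rewrite b0.
have h : `|S b x0 - S a x0| <= e / 2.
  have hd : `|b - a| < d by move: ab; rewrite lt_min => /andP[].
  have [h1|h1] := leP a b.
    apply: le_trans (diff _ _ _ aN1 bN1 h1) _.
    rewrite mulrC -ler_pdivlMr// ltW// dS// subr_ge0 h1/=.
    by apply: le_lt_trans hd; exact: ler_norm.
  rewrite distrC; apply: le_trans (diff _ _ _ bN1 aN1 (ltW h1)) _.
  rewrite mulrC -ler_pdivlMr// ltW// dS// subr_ge0 (ltW h1)/=.
  by apply: le_lt_trans hd; rewrite distrC; exact: ler_norm.
rewrite -(subrKA (S b x0)) [e]splitr.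
apply: le_lt_trans (ler_normD _ _) _; apply: ler_ltD; first by rewrite distrC.
rewrite -(linearB (S b)); apply: le_lt_trans (SM _ _ bN1) _.
by rewrite mulrC -ltr_pdivlMr.
Unshelve. all: by end_near. Qed.

End Semigroup.

(** * Integrability criteria *)

Section ScaleVector.
Context (R : realType) (V : normedModType R).

(** Multiplication of a fixed vector, seen as a linear map of the scalar:
products of a measurable scalar and a continuous vector become an operator
family. *)
Definition scale_vec (a : V) (x : R^o) : V := (x : R) *: a.

Lemma scale_vec_is_linear (a : V) : linear (scale_vec a).
Proof. by move=> k x y; rewrite /scale_vec scalerDl scalerA. Qed.

HB.instance Definition _ (a : V) :=
  GRing.isLinear.Build R R^o V *:%R (scale_vec a) (scale_vec_is_linear a).
End ScaleVector.

Section MeasurableReal.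
Import HBSimple.
Context (R : realType).
Local Notation mu := (@lebesgue_measure R).

Lemma strongly_measurable_of_measurable (D : set R) (v : R -> R) :
  measurable D -> (mu D < +oo)%E ->
  measurable_fun D v -> strongly_measurable D (v : R -> R^o).
Proof.
move=> mD fD mv.
have mev : measurable_fun D (EFin \o v) by apply/measurable_EFinP.
have [g gv] := approximation_sfun mD mev.
have fmu (A : set R) : measurable A -> (mu (A `&` D) < +oo)%E.
  move=> mA; apply: le_lt_trans fD; apply: le_measure; rewrite ?inE//.
  exact: measurableI.
pose r n : seq R := finmap.enum_fset (fset_set (range (g n : R -> R))).
have mS n (i : 'I_(size (r n))) : measurable (g n @^-1` [set (r n)`_i] `&` D).
  by apply: measurableI => //; exact: measurable_funPTI.
have fS n (i : 'I_(size (r n))) : (mu (g n @^-1` [set (r n)`_i] `&` D) < +oo)%E.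
  by apply: fmu; exact: measurable_funPTI.
exists (fun n => @Defs.SimpleFun R R^o (size (r n))
  (fun i => g n @^-1` [set (r n)`_i] `&` D)
  (fun i => (r n)`_i) (mS n) (fS n)) => t Dt.
have /fine_cvgP[_ gvt] := gv t Dt.
apply: cvg_trans gvt; apply: near_eq_cvg; apply: nearW => n /=.
rewrite /sf_eval/= fimfunE fsbig_finite//=.
rewrite (big_nth 0) big_mkord; apply: eq_bigr => i _.
by rewrite indicI /= (indicE _ D) (mem_set Dt) mulr1 mulrC.
Qed.

End MeasurableReal.

Section Tools.
Context (R : realType).
Local Notation mu := (@lebesgue_measure R).

Lemma ae_mono (P Q : R -> Prop) : (forall t, P t -> Q t) ->
  {ae mu, forall t, P t} -> {ae mu, forall t, Q t}.
Proof. exact: (@filterS _ _ (ae_filter_ringOfSetsType mu)). Qed.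

Lemma ae_and (P Q : R -> Prop) :
  {ae mu, forall t, P t} -> {ae mu, forall t, Q t} ->
  {ae mu, forall t, P t /\ Q t}.
Proof. exact: (@filterI _ _ (ae_filter_ringOfSetsType mu)). Qed.

Section Finite.
Context (D : set R) (mD : measurable D) (fD : (mu D < +oo)%E).

Lemma strongly_measurable_scale (V : normedModType R) (v : R -> R)
  (Psi : R -> V) :
  (forall t, D t -> 0 <= t) -> measurable_fun D v -> continuous Psi ->
  strongly_measurable D (fun t => v t *: Psi t).
Proof.
move=> D0 mv cPsi.
apply: (@strongly_measurable_op_family R R^o V D (fun t => scale_vec (Psi t) :
  {linear R^o -> V}) v) => //.
  move=> [a b]; apply:
    (@cvgZ _ _ _ _ _ (fun z : R * R^o => z.2 : R) (fun z => Psi z.1)).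
    exact: cvg_snd.
  have h : z.1 @[z --> (a, b)] --> a by exact: cvg_fst.
  exact: (cvg_comp _ _ h (cPsi a)).
exact: strongly_measurable_of_measurable.
Qed.

Lemma strongly_measurable_continuous (V : normedModType R) (Psi : R -> V) :
  (forall t, D t -> 0 <= t) -> continuous Psi -> strongly_measurable D Psi.
Proof.
move=> D0 cPsi; have := @strongly_measurable_scale V (cst 1) Psi D0
  (measurable_cst _) cPsi.
by apply: strongly_measurable_ext => t _; rewrite scale1r.
Qed.

Lemma bochner_L1_add (V : normedModType R) (f g : R -> V) :
  bochner_L1 D f -> bochner_L1 D g -> bochner_L1 D (fun t => f t + g t).
Proof.
move=> [mf f1] [mg g1]; split; first exact: strongly_measurable_add.
by apply: le_lt_trans (le_integral_normD mD mf mg) _; exact: lte_add_pinfty.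
Qed.

Lemma bochner_L1_dominated (V W : normedModType R) (f : R -> V) (g : R -> W)
  (C : R) :
  0 <= C -> strongly_measurable D f -> bochner_L1 D g ->
  {ae mu, forall t, D t -> `|f t| <= C * `|g t|} -> bochner_L1 D f.
Proof.
move=> C0 mf [mg g1] fg; split=> //.
apply: (@le_lt_trans _ _ (\int[mu]_(t in D) (C * `|g t|)%:E)%E).
  apply: ae_ge0_le_integral => //.
  - by apply/measurable_EFinP; exact: measurable_norm_strongly_measurable.
  - by move=> t _; rewrite lee_fin mulr_ge0.
  - apply/measurable_EFinP; apply: measurable_funM => //.
    exact: measurable_norm_strongly_measurable.
under eq_integral do rewrite EFinM.
rewrite ge0_integralZl//.
- by rewrite lte_mul_pinfty.
- by apply/measurable_EFinP; exact: measurable_norm_strongly_measurable.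
Qed.

Lemma bochner_L1_bounded (V : normedModType R) (f : R -> V) (C : R) :
  strongly_measurable D f ->
  {ae mu, forall t, D t -> `|f t| <= C} -> bochner_L1 D f.
Proof.
move=> mf fC; pose C' := Num.max C 0.
have C'0 : 0 <= C' by rewrite le_max lexx orbT.
have m1 : bochner_L1 D (fun=> 1 : R^o).
  split; first by apply: strongly_measurable_of_measurable => //; exact:
    measurable_cst.
  under eq_integral do rewrite normr1.
  by rewrite integral_cst// mul1e.
apply: (bochner_L1_dominated C'0 mf m1).
by apply: ae_mono fC => t h Dt;
  rewrite normr1 mulr1 (le_trans (h Dt))// le_max lexx.
Qed.

Lemma bochner_integral_norm_le (V : normedModType R)
  (f : R -> V) v (k : R -> R) :
  has_bochner_integral D f v -> measurable_fun D k ->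
    (forall t, D t -> 0 <= k t) ->
  {ae mu, forall t, D t -> `|f t| <= k t} ->
  (`|v|%:E <= \int[mu]_(t in D) (k t)%:E)%E.
Proof.
move=> hf mk k0 fk; apply: le_trans (le_norm_bochner_integral mD fD hf) _.
apply: ae_ge0_le_integral => //.
- by apply/measurable_EFinP; apply: measurable_norm_strongly_measurable => //;
    case: hf.
- by apply/measurable_EFinP.
Qed.

End Finite.

Lemma lebesgue_measure_oo_lty (a b : R) : (mu `]a, b[%classic < +oo)%E.
Proof. by rewrite lebesgue_measure_itv /=; case: ifP => _;
  rewrite ?ltry// -EFinB ltry. Qed.

Lemma integral_exp_le (a c lam t : R) : 0 <= a -> 0 <= c -> 0 < lam -> 0 <= t ->
  (\int[mu]_(s in `]0%R, t[) (a + c * expR (lam * s))%:E <=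
   (a * t + c / lam * expR (lam * t))%:E)%E.
Proof.
move=> a0 c0 l0; rewrite le_eqVlt => /predU1P[<-|t0].
  rewrite set_itv_ge ?bnd_simp ?ltxx// integral_set0 lee_fin mulr0 add0r.
  by rewrite mulr_ge0 ?divr_ge0 ?expR_ge0 ?(ltW l0).
have ck : continuous (fun s : R => a + c * expR (lam * s)).
  move=> s; apply: cvgD; first exact: cvg_cst.
  apply: cvgMr; apply: continuous_cvg; first exact: continuous_expR.
  by apply: cvgMr; exact: cvg_id.
have k0 s : 0 <= a + c * expR (lam * s) by rewrite addr_ge0// mulr_ge0
  ?expR_ge0.
apply: (@le_trans _ _ (\int[mu]_(s in `[0%R, t])
  (a + c * expR (lam * s))%:E)%E).
  apply: ge0_subset_integral => //.
  - apply/measurable_EFinP; apply: measurable_funTS.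
    exact: continuous_measurable_fun.
  - by move=> s _; rewrite lee_fin.
  - exact: subset_itv_oo_cc.
pose F s : R := a * s + c / lam * expR (lam * s).
have dF s : is_derive s (1 : R) F (a + c * expR (lam * s)).
  have lin k : is_derive s (1 : R) (fun s : R => k * s) k.
    have := is_deriveZ k (is_derive_id s (1 : R)).
    by rewrite [_%:A](_ : _ = k)//; exact: mulr1.
  have h : is_derive s (1 : R) (expR \o (fun s : R => lam * s))
    (expR (lam * s) * lam).
    exact: (@is_derive1_comp _ _ (fun s => lam * s) _ _ _ (is_derive_expR _)
      (lin lam)).
  have := is_deriveD (lin a) (is_deriveZ (c / lam) h).
  rewrite [X in is_derive _ _ _ X -> _](_ : _ = a + c * expR (lam * s))//.
  by rewrite /GRing.scale /= [expR _ * _]mulrC mulrA divfK ?gt_eqF.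
have cF : continuous F.
  by move=> s; apply/differentiable_continuous/derivable1_diffP; case: (dF s).
rewrite (@continuous_FTC2 _ _ F)//.
- rewrite -EFinB lee_fin /F mulr0 add0r mulr0 expR0 mulr1 lerBlDr lerDl.
  by rewrite divr_ge0// ltW.
- exact: continuous_subspaceT.
- split; first by move=> s _; case: (dF s).
  + exact: cvg_at_right_filter (cF 0).
  + exact: cvg_at_left_filter (cF t).
- by move=> s _; rewrite derive1E; case: (dF s).
Qed.
End Tools.

(** * Convolution with a semigroup *)

Section Convolution.
Context (R : realType) (H : completeNormedModType R) (S : R -> 'L(H, H)).
Local Notation mu := (@lebesgue_measure R).
Hypothesis C0 : C0_semigroup S.

Lemma strongly_measurable_semigroup (D : set R) (g : R -> H) t :
  (forall s, D s -> 0 <= s) ->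
  strongly_measurable D g ->
  strongly_measurable D (fun s => S (Num.max (t - s) 0) (g s)).
Proof.
move=> D0; apply: (@strongly_measurable_op_family R H H D (fun s =>
  S (Num.max (t - s) 0))) => //.
move=> [a b].
have h : (t - z.1, z.2) @[z --> (a, b)] --> (t - a, b).
  have h1 : t - z.1 @[z --> (a, b)] --> t - a.
    by apply: cvgB; [exact: cvg_cst|exact: cvg_fst].
  have h2 : z.2 @[z --> (a, b)] --> b by exact: cvg_snd.
  exact: (cvg_pair h1 h2).
exact: (cvg_comp _ _ h (@semigroup_jointly_continuous _ _ _ C0 (t - a, b))).
Qed.

(** Extending the integrand by zero past time [t] puts all these integrals on
one interval, where dominated convergence gives the continuity. *)
Lemma convolution_exists (T : R) (g : R -> H) : bochner_L1 `]0, T[ g ->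
  exists2 w : R -> H, continuous w &
    forall t, 0 <= t <= T ->
      has_bochner_integral `]0, t[ (fun s => S (t - s) (g s)) (w t).
Proof.
set D := `]0, T[%classic => L1g; have [mg Lg] := L1g.
have mD : measurable D by exact: measurable_itv.
have fD : (mu D < +oo)%E by exact: lebesgue_measure_oo_lty.
have D0 s : D s -> 0 <= s by rewrite /D /= in_itv /= => /andP[/ltW].
pose E (t : R) := `]0, t[%classic.
have mE t : measurable (E t) by exact: measurable_itv.
pose G t s := (\1_(E t) s : R) *: S (Num.max (t - s) 0) (g s).
have mG t : strongly_measurable D (G t).
  have : strongly_measurable D (fun s => (\1_(E t `&` D) s : R) *:
    S (Num.max (t - s) 0) (g s)).
    apply: strongly_measurable_patch; first exact: measurableI.
    apply: strongly_measurable_semigroup => [s [_ /D0//]|]; apply: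
      strongly_measurable_subset mg; exact: subIsetr.
  apply: strongly_measurable_ext => s Ds;
    rewrite /G indicI /= [X in _ * X]indicE mem_set//.
  by rewrite mulr1.
have GM N : exists2 M, 0 < M & forall t s, t <= N -> D s ->
  `|G t s| <= M * `|g s|.
  have [M M0 SM] := semigroup_bounded C0 (Num.max N 0); exists M =>
    // t s tN Ds.
  rewrite /G normrZ indicE; case: (_ \in _); last first.
    by rewrite normr0 mul0r mulr_ge0// ltW.
  rewrite normr1 mul1r; apply: SM; rewrite le_max lexx orbT/=.
  rewrite ge_max le_max [X in _ && X]le_max lexx orbT andbT.
  apply/orP; left; apply: le_trans tN; rewrite gerBl; exact: D0.
have L1G t : bochner_L1 D (G t).
  have [M M0 GMt] := GM t.
  apply: (bochner_L1_dominated mD (ltW M0) (mG t) L1g).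
  by apply: aeW => s Ds; exact: GMt.
have /choice[w wP] t := bochner_integral_exists mD fD (L1G t).
exists w; last first.
  move=> t /andP[t0 tT].
  have ED : E t `<=` D.
    by move=> s; rewrite /E /D /= !in_itv /= => /andP[-> /lt_le_trans]; apply.
  have fE : (mu (E t) < +oo)%E by exact: lebesgue_measure_oo_lty.
  have L1E : bochner_L1 (E t) (fun s => S (t - s) (g s)).
    have [M M0 GMt] := GM t.
    have mS : strongly_measurable (E t) (fun s => S (t - s) (g s)).
      have : strongly_measurable (E t) (fun s => S (Num.max (t - s) 0) (g s)).
        apply: strongly_measurable_semigroup => [s /ED/D0//|]; exact:
          strongly_measurable_subset mg.
      apply: strongly_measurable_ext => s; rewrite /E /= in_itv /= =>
        /andP[_ st].
      by rewrite (max_idPl _)// subr_ge0 ltW.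
    have L1gE : bochner_L1 (E t) g.
      split; first exact: strongly_measurable_subset mg.
      apply: le_lt_trans Lg; apply: ge0_subset_integral => //.
      - exact: mE.
      - by apply/measurable_EFinP; exact: measurable_norm_strongly_measurable.
    apply: (bochner_L1_dominated (mE t) (ltW M0) mS L1gE).
    apply: aeW => s Es; have := GMt t s (lexx _) (ED _ Es).
    rewrite /G indicE mem_set// scale1r (max_idPl _)// subr_ge0 ltW//.
    by move: Es; rewrite /E /= in_itv /= => /andP[].
  have [v hv] := bochner_integral_exists (mE t) fE L1E.
  suff -> : w t = v by exact: hv.
  apply: (bochner_integral_unique mD fD (wP t)).
  have := bochner_integral_patch mD (mE t) ED hv; apply: bochner_integral_ext =>
    s Ds.
  rewrite /G indicE; have [/set_mem|_] := boolP (s \in E t);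
    last by rewrite !scale0r.
  by rewrite /E /= in_itv /= => /andP[_ st];
    rewrite (max_idPl _)// subr_ge0 ltW.
move=> t0; apply/cvgrPdist_lt => e e0; apply: contrapT => nw.
have /choice[u uP] : forall n : nat, exists t, `|t0 - t| < n.+1%:R^-1 /\
  e <= `|w t0 - w t|.
  move=> n; apply: contrapT => /forallNP nt; apply: nw.
  apply/nbhs_ballP; exists n.+1%:R^-1 => /=; first by rewrite invr_gt0.
  move=> t /= ht; rewrite ltNge; apply/negP => h.
  by apply: (nt t); split.
have ut0 : u n @[n --> \oo] --> t0.
  apply/cvgrPdist_lt => d d0; near=> n.
  apply: lt_trans (proj1 (uP n)) _.
  near: n; have /cvgr0Pnorm_lt/(_ _ d0) := @cvg_harmonic R.
  by apply: filterS => n /=; rewrite ger0_norm.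
have [M M0 GMN] := GM (`|t0| + 1).
have uN n : u n <= `|t0| + 1.
  have h1 : `|t0 - u n| < 1.
    by apply: lt_le_trans (proj1 (uP n)) _; rewrite invf_le1 ?ler1n.
  have := ler_norm (u n - t0); have := ler_norm t0; rewrite distrC; lra.
have t0N : t0 <= `|t0| + 1 by have := ler_norm t0; lra.
(* convergence may fail at [s = t0], where the indicator jumps *)
have cvG s : s != t0 -> D s -> G (u n) s @[n --> \oo] --> G t0 s.
  move=> st0 Ds; have [ltst|ltts] := ltP s t0.
  - have sE : s \in E t0.
      by rewrite mem_set// /E /= in_itv /= ltst andbT; move: Ds;
        rewrite /D /= in_itv /= => /andP[].
    have hS : S (Num.max (u n - s) 0) (g s) @[n --> \oo] -->
      S (Num.max (t0 - s) 0) (g s).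
      have h : (u n - s, g s) @[n --> \oo] --> (t0 - s, g s).
        have h1 : u n - s @[n --> \oo] --> t0 - s.
          by apply: cvgB => //; exact: cvg_cst.
        exact: (cvg_pair h1 (cvg_cst (g s))).
      exact: (cvg_comp _ _ h
        (@semigroup_jointly_continuous _ _ _ C0 (t0 - s, g s))).
    rewrite {2}/G indicE sE scale1r; apply: cvg_trans hS; apply: near_eq_cvg.
    have /cvgr_gt/(_ _ ltst) unear := ut0.
    near=> n; rewrite /G indicE mem_set ?scale1r// /E /= in_itv /=.
    apply/andP; split; first by move: Ds; rewrite /D /= in_itv /= => /andP[].
    by near: n; exact: unear.
  - have ltts' : t0 < s by rewrite lt_neqAle eq_sym st0.
    rewrite {2}/G indicE memNset ?scale0r; last first.
      by rewrite /E /= in_itv /= => /andP[_]; rewrite ltNge ltts.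
    have /cvgr_lt/(_ _ ltts') unear := ut0.
    apply: cvg_near_cst; near=> n.
    rewrite /G indicE memNset ?scale0r// /E /= in_itv /= => /andP[_].
    apply/negP; rewrite -leNgt ltW//.
    by near: n; exact: unear.
have ms n : strongly_measurable D (fun s => G t0 s - G (u n) s) by exact:
  strongly_measurable_sub.
have [] := @dominated_convergence _ _ _ mu D mD
    (fun n s => `|G t0 s - G (u n) s|%:E) (cst 0%E)
      (fun s => (2 * M * `|g s|)%:E).
- by move=> n; apply/measurable_EFinP; exact:
    measurable_norm_strongly_measurable.
- exact: measurable_cst.
- exists [set t0]; split;
    [exact: measurable_set1|exact: lebesgue_measure_set1|].
  move=> s /= hs; apply: contrapT => /eqP st0; apply: hs => Ds.
  apply: cvg_EFin; first exact: nearW.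
  have h : G t0 s - G (u n) s @[n --> \oo] --> G t0 s - G t0 s.
    by apply: cvgB; [exact: cvg_cst|exact: cvG].
  by move/cvg_norm : h; rewrite subrr normr0.
- under eq_fun do rewrite EFinM; apply: integrableZl => //.
  apply/integrableP; split; first by apply/measurable_EFinP; exact:
    measurable_norm_strongly_measurable.
  by under eq_integral do rewrite /= normr_id.
- apply: aeW => s n Ds /=; rewrite normr_id lee_fin.
  apply: le_trans (ler_normB _ _) _.
  by rewrite mulr2n !mulrDl mul1r lerD// GMN.
move=> _ + _; rewrite /= => /cvge0_epsP h.
have e2 : 0 < e / 2 by rewrite divr_gt0.
have [|n hn] := filter_ex (h _ _ e2).
  by move=> n; apply: integral_ge0 => s _; rewrite lee_fin.
have : (`|w t0 - w (u n)|%:E <= (e / 2)%:E)%E.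
  apply: le_trans (le_norm_bochner_integral mD fD
    (bochner_integral_sub mD (wP t0) (wP (u n)))) _.
  apply: le_trans hn; rewrite le_eqVlt; apply/orP; left; apply/eqP.
  by apply: eq_integral => s _ /=; rewrite subr0 normr_id.
rewrite lee_fin => /(le_trans (proj2 (uP n))).
by rewrite leNgt ltr_pdivrMr// ltr_pMr// ltr1n.
Unshelve. all: by end_near. Qed.
End Convolution.

(** * Weighted estimates *)

Section Volterra.
Context (R : realType).
Local Notation mu := (@lebesgue_measure R).

Lemma bochner_integral_exp_le (V : normedModType R) (a c lam t : R)
  (z : R -> V) v :
  0 <= a -> 0 <= c -> 0 < lam -> 0 <= t -> has_bochner_integral `]0, t[ z v ->
  {ae mu, forall s, `]0, t[%classic s -> `|z s| <= a + c * expR (lam * s)} ->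
  `|v| <= a * t + c / lam * expR (lam * t).
Proof.
move=> a0 c0 l0 t0 hz zk; rewrite -lee_fin.
apply: le_trans (integral_exp_le a0 c0 l0 t0).
apply: (bochner_integral_norm_le _ _ hz) => //.
- exact: lebesgue_measure_oo_lty.
- apply: measurable_funTS; apply: continuous_measurable_fun => s.
  apply: cvgD; first exact: cvg_cst.
  apply: cvgMr; apply: continuous_cvg; first exact: continuous_expR.
  by apply: cvgMr; exact: cvg_id.
- by move=> s _; rewrite addr_ge0// mulr_ge0 ?expR_ge0.
Qed.

(** With the weight [expR (- lam * t)] the Volterra term costs only half of the
supremum to be bounded, so it can be absorbed. *)
Lemma weighted_gronwall (T A lam : R) (d : R -> R) : 0 <= T -> 0 <= lam ->
  {within `[0, T], continuous d} -> (forall t, 0 <= t <= T -> 0 <= d t) ->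
  (forall c, 0 <= c -> (forall s, 0 <= s <= T -> d s <= c * expR (lam * s)) ->
     forall t, 0 <= t <= T -> d t <= A + c / 2 * expR (lam * t)) ->
  forall t, 0 <= t <= T -> d t <= 2 * A * expR (lam * T).
Proof.
move=> T0 l0 cd d0 dA.
pose phi t := d t * expR (- (lam * t)).
have cphi : {within `[0, T], continuous phi}.
  move=> t; apply: cvgM; first exact: cd.
  have : continuous (fun t : R => expR (- (lam * t))).
    move=> s; apply: continuous_cvg; first exact: continuous_expR.
    by apply: cvgN; apply: cvgMr; exact: cvg_id.
  by move/continuous_subspaceT; exact.
have [ts tsT phiM] := EVT_max T0 cphi.
rewrite in_itv /= in tsT.
have c0 : 0 <= phi ts by rewrite mulr_ge0 ?expR_ge0 ?d0.
have dphi s : d s = phi s * expR (lam * s).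
  by rewrite /phi -mulrA -expRD addNr expR0 mulr1.
have dc s : 0 <= s <= T -> d s <= phi ts * expR (lam * s).
  by move=> sT; rewrite dphi ler_pM2r ?expR_gt0// phiM// in_itv.
have := dA _ c0 dc ts tsT; rewrite dphi.
have e1 : 1 <= expR (lam * ts).
  by rewrite -expR0 ler_expR mulr_ge0//; case/andP: tsT.
move=> h; have A2 : phi ts <= 2 * A by nra.
move=> t tT; apply: le_trans (dc _ tT) _.
apply: ler_pM => //.
by rewrite ler_expR ler_wpM2l//; case/andP: tT.
Qed.

Lemma geometric_uniform_limit (V : completeNormedModType R) (Y : nat -> R -> V)
  (C : R) :
  (forall n, continuous (Y n)) ->
  (forall n t, `|Y n.+1 t - Y n t| <= C / 2 ^+ n) ->
  exists2 Z : R -> V, continuous Z & forall n t,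
    `|Z t - Y n t| <= 2 * C / 2 ^+ n.
Proof.
move=> cY dY.
have C0 : 0 <= C by have := dY 0 0; rewrite expr0 divr1; exact: le_trans.
have two n : (0 : R) < 2 ^+ n by rewrite exprn_gt0.
have tail n k t : `|Y (n + k)%N t - Y n t| <= 2 * C / 2 ^+ n - 2 * C / 2 ^+
  (n + k)%N.
  elim: k => [|k IH]; first by rewrite addn0 !subrr normr0.
  rewrite addnS -(subrKA (Y (n + k)%N t)).
  apply: le_trans (ler_normD _ _) _; apply: le_trans (lerD (dY _ _) IH) _.
  by rewrite exprS invfM; lra.
have tail' n m t : (n <= m)%N -> `|Y m t - Y n t| <= 2 * C / 2 ^+ n.
  move=> /subnKC <-; apply: le_trans (tail _ _ _) _.
  by rewrite gerBl divr_ge0 ?mulr_ge0// ltW.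
have small (e : R) : 0 < e -> exists n, 2 * C / 2 ^+ n < e.
  move=> e0; have := @cvg_geometric R (2 * C) 2^-1.
  rewrite ger0_norm// invf_lt1// ltr1n => /(_ isT)/cvgr0Pnorm_lt/(_ _ e0) h.
  have [n hn] := filter_ex h; exists n.
  by apply: le_lt_trans hn; rewrite /= -exprVn; exact: ler_norm.
have cvgY t : cvg (Y n t @[n --> \oo]).
  apply/cauchy_cvgP/cauchy_exP => e e0; have [n hn] := small _ e0.
  exists (Y n t); exists n => // m /= nm.
  by rewrite -ball_normE /= distrC; apply: le_lt_trans hn; exact: tail'.
pose Z t := lim (Y n t @[n --> \oo]).
have YZ n t : `|Z t - Y n t| <= 2 * C / 2 ^+ n.
  have cd : `|Y m t - Y n t| @[m --> \oo] --> `|Z t - Y n t|.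
    by apply: cvg_norm; apply: cvgB; [exact: cvgY|exact: cvg_cst].
  by apply: (cvgr_to_le cd); exists n => // m /= nm; exact: tail'.
exists Z => // t; apply/cvgrPdist_lt => e e0.
have e3 : 0 < e / 3 by rewrite divr_gt0.
have [n hn] := small _ e3.
have /cvgrPdist_lt/(_ _ e3) := cY n t; apply: filterS => s hs.
have h1 := le_lt_trans (YZ n t) hn; have h2 := le_lt_trans (YZ n s) hn.
rewrite -(subrKA (Y n t)) -[Y n t - _](subrKA (Y n s)).
apply: le_lt_trans (ler_normD _ _) _.
apply: le_lt_trans (lerD (lexx _) (ler_normD _ _)) _.
rewrite [`|Y n s - _|]distrC; lra.
Qed.

End Volterra.

(** * Existence of mild states *)

Section Clamp.
Context (R : realType) (T : R).
Hypothesis T0 : 0 <= T.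

(** Composing with this retraction extends a function on the time interval to
the line without losing continuity. *)
Definition clamp (t : R) : R := Num.max 0 (Num.min T t).

Lemma clamp_itv t : 0 <= clamp t <= T.
Proof. by rewrite /clamp le_max lexx /= ge_max T0 ge_min lexx. Qed.

Lemma clamp_id t : 0 <= t <= T -> clamp t = t.
Proof.
by move=> /andP[t0 tT]; rewrite /clamp (min_idPr tT) (max_idPr t0).
Qed.

Lemma clamp_continuous : continuous clamp.
Proof.
move=> t; apply/cvgrPdist_lt => e e0; apply/nbhs_ballP; exists e => //= s.
move=> ts; apply: le_lt_trans ts.
have h1 := ler_norm (t - s); have h2 := ler_norm (s - t); rewrite distrC in h2.
have TT := T0; rewrite ler_norml /clamp.
case: (leP T t) => a; case: (leP T s) => b;
  [case: (leP 0 T) | case: (leP 0 T); case: (leP 0 s) |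
   case: (leP 0 T); case: (leP 0 t) | case: (leP 0 t); case: (leP 0 s)] => *;
     lra.
Qed.

Lemma continuous_comp_clamp (V : normedModType R) (f : R -> V) :
  {within `[0, T], continuous f} -> continuous (f \o clamp).
Proof.
move=> /subspace_continuousP cf t; apply/cvgrPdist_lt => e e0.
have ct : `[0, T]%classic (clamp t) by rewrite /= in_itv /= clamp_itv.
have /cvgrPdist_lt/(_ _ e0) := cf _ ct.
rewrite near_withinE => h.
have : \forall s \near t, `[0, T]%classic (clamp s) ->
  `|f (clamp t) - f (clamp s)| < e.
  exact: (@clamp_continuous t _ h).
by apply: filterS => s; apply; rewrite /= in_itv /= clamp_itv.
Qed.

Lemma continuous_itv_bounded (V : normedModType R) (f : R -> V) :
  {within `[0, T], continuous f} ->
  exists2 C, 0 <= C & forall t, 0 <= t <= T -> `|f t| <= C.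
Proof.
move=> cf.
have cnf : {within `[0, T], continuous (fun t => `|f t|)}.
  by move=> t; exact: (cvg_comp _ _ (cf t) (@norm_continuous _ _ (f t))).
have [c _ fc] := EVT_max T0 cnf.
by exists `|f c| => // t tT; apply: fc; rewrite in_itv.
Qed.

End Clamp.

Section Existence.
Context (R : realType) (H : completeNormedModType R) (S : R -> 'L(H, H)).
Local Notation mu := (@lebesgue_measure R).
Hypothesis C0 : C0_semigroup S.
Context (T : R) (T0 : 0 < T) (f : R -> H) (L1f : bochner_L1 `]0, T[ f).
Context (B1 : H) (B2 : 'L(H, H)) (Psi0 : H) (v : R -> R) (K : R).
Hypothesis mv : measurable_fun `]0, T[%classic v.
Hypothesis K0 : 0 <= K.
Hypothesis vK : {ae mu, forall t, `]0, T[%classic t -> `|v t| <= K}.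

Let D : set R := `]0, T[%classic.
Let mD : measurable D. Proof. exact: measurable_itv. Qed.
Let fD : (mu D < +oo)%E. Proof. exact: lebesgue_measure_oo_lty. Qed.
Let D0 s : D s -> 0 <= s. Proof. by rewrite /D /= in_itv /= => /andP[/ltW]. Qed.
Let DT s : D s -> 0 <= s <= T.
Proof. by rewrite /D /= in_itv /= => /andP[/ltW-> /ltW->]. Qed.

Lemma bochner_L1_scale (V : normedModType R) (Psi : R -> V) :
  continuous Psi -> bochner_L1 D (fun t => v t *: Psi t).
Proof.
move=> cPsi; have [C C_0 PC] := continuous_itv_bounded (ltW T0)
  (continuous_subspaceT cPsi).
apply: (bochner_L1_bounded mD fD (C := K * C)).
  exact: strongly_measurable_scale.
apply: ae_mono vK => t h Dt; rewrite normrZ ler_pM// ?h// PC//.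
exact: DT.
Qed.

Let g (Psi : R -> H) s := f s + v s *: (B1 + B2 (Psi s)).

Let L1g Psi : continuous Psi -> bochner_L1 D (g Psi).
Proof.
move=> cPsi; apply: bochner_L1_add => //; apply: bochner_L1_scale.
move=> t; apply: cvgD; first exact: cvg_cst.
by apply: continuous_cvg; [exact: bop_continuous|exact: cPsi].
Qed.

Let is_step (Psi Phi : R -> H) := continuous Psi -> continuous Phi /\
  forall t, 0 <= t <= T -> exists2 w : H,
    has_bochner_integral `]0, t[ (fun s => S (t - s) (g Psi s)) w &
    Phi t = S t Psi0 + w.

Let step_exists Psi : exists Phi, is_step Psi Phi.
Proof.
have [cPsi|] := pselect (continuous Psi); last by exists (fun=> 0).
have [w cw hw] := convolution_exists C0 (L1g cPsi).
exists (fun t => S (Num.max t 0) Psi0 + w t) => _; split.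
  move=> t; apply: cvgD; last exact: cw.
  have h : (s, Psi0) @[s --> t] --> (t, Psi0) by exact:
    (cvg_pair cvg_id (cvg_cst _)).
  exact: (cvg_comp _ _ h (@semigroup_jointly_continuous _ _ _ C0 (t, Psi0))).
move=> t tT; exists (w t); first exact: hw.
by rewrite (max_idPl _)//; case/andP: tT.
Qed.

Let step_contracts : exists2 lam : R, 0 < lam &
  forall Psi Psi' Phi Phi' (c : R),
  continuous Psi -> continuous Psi' -> is_step Psi Phi -> is_step Psi' Phi' ->
  0 <= c -> (forall s, 0 <= s <= T ->
    `|Psi s - Psi' s| <= c * expR (lam * s)) ->
  forall t, 0 <= t <= T -> `|Phi t - Phi' t| <= c / 2 * expR (lam * t).
Proof.
have [M M0 SM] := semigroup_bounded C0 T.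
pose L := M * (K * opnorm B2).
have L0 : 0 <= L by rewrite !mulr_ge0 ?opnorm_ge0// ltW.
(* [L] is a Lipschitz constant of the integrand, so that [L / lam <= 1 / 2] *)
pose lam := 2 * L + 1; have l0 : 0 < lam by rewrite /lam; lra.
exists lam => // Psi Psi' Phi Phi' c cPsi cPsi' hPhi hPhi' c0 dc t tT.
have [_ /(_ t tT)[w hw ->]] := hPhi cPsi.
have [_ /(_ t tT)[w' hw' ->]] := hPhi' cPsi'.
rewrite opprD addrACA subrr add0r.
have h := bochner_integral_sub (measurable_itv _) hw hw'.
have /andP[t0 _] := tT.
apply: (@le_trans _ _ (0 * t + (L * c) / lam * expR (lam * t))).
  apply: (bochner_integral_exp_le _ _ l0 t0 h) => //; first exact: mulr_ge0.
  apply: ae_mono vK => s vs st.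
  have Ds : D s.
    by move: st tT; rewrite /D /= !in_itv /= => /andP[-> st] /andP[_]; exact:
      lt_le_trans.
  rewrite add0r -(linearB (S (t - s))) /g opprD addrACA subrr add0r.
  rewrite -scalerBr opprD addrACA subrr add0r.
  have st0 : 0 <= t - s <= T.
    move: st tT; rewrite /= in_itv /= => /andP[h1 h2] /andP[h3 h4].
    by rewrite subr_ge0 ltW//=; lra.
  apply: le_trans (SM _ _ st0) _; rewrite /L -!mulrA ler_pM2l//.
  rewrite normrZ ler_pM// ?vs// -(linearB B2).
  apply: le_trans (opnorm_ler _ _) _.
  by rewrite ler_wpM2l ?opnorm_ge0// dc// DT.
rewrite mul0r add0r ler_wpM2r ?expR_ge0// mulrAC mulrC ler_wpM2l//.
by rewrite ler_pdivrMr// /lam; lra.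
Qed.

(** Picard iteration: successive differences are halved in the weighted norm.
The state of a control is a chosen solution, so this is what gives a meaning to
the cost of a perturbed control. *)
Lemma mild_state_exists : exists Psi, mild_state T S f B1 B2 Psi0 v Psi.
Proof.
have /choice[step stepP] := step_exists.
have [lam l0 contr] := step_contracts.
pose X n := iter n step (fun=> 0).
have cX n : continuous (X n).
  elim: n => [|n IH]; first by move=> t; exact: cvg_cst.
  by have [] := stepP _ IH.
have [C C_0 hC] : exists2 C, 0 <= C & forall t, 0 <= t <= T ->
  `|X 1%N t - X 0%N t| <= C.
  apply: (@continuous_itv_bounded _ _ (ltW T0) _ (fun t => X 1%N t - X 0%N t)).
  apply: continuous_subspaceT => t.
  by apply: (@cvgB _ _ _ _ _ (X 1%N) (X 0%N)); exact: cX.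
have dX n t : 0 <= t <= T -> `|X n.+1 t - X n t| <= C / 2 ^+ n * expR (lam * t).
  elim: n t => [|n IH] t tT.
    apply: le_trans (hC _ tT) _; rewrite expr0 divr1 ler_peMr//.
    by rewrite -expR0 ler_expR mulr_ge0 ?(ltW l0)//; case/andP: tT.
  rewrite exprS invfM [2^-1 * _]mulrC mulrA.
  apply: (contr (X n.+1) (X n)) => //; try exact: stepP.
  by rewrite divr_ge0// exprn_ge0.
pose E := expR (lam * T).
have [Z cZ ZX] : exists2 Z : R -> H, continuous Z &
    forall n t, `|Z t - X n (clamp T t)| <= 2 * (C * E) / 2 ^+ n.
  apply: (geometric_uniform_limit (Y := fun n t => X n (clamp T t))).
    move=> n; apply: (@continuous_comp_clamp _ _ (ltW T0) _ (X n)).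
    exact: continuous_subspaceT.
  move=> n t; apply: le_trans (dX _ _ (clamp_itv (ltW T0) t)) _.
  rewrite mulrAC ler_wpM2r ?invr_ge0 ?exprn_ge0// ler_wpM2l// ler_expR.
  by rewrite ler_wpM2l ?(ltW l0)//; case/andP: (clamp_itv (ltW T0) t).
have {}ZX n t : 0 <= t <= T -> `|Z t - X n t| <= 2 * (C * E) / 2 ^+ n.
  by move=> tT; have := ZX n t; rewrite clamp_id.
exists Z; split; first exact: continuous_subspaceT.
move=> t; rewrite in_itv /= => tT.
have [_ /(_ t tT)[w hw sw]] := stepP _ cZ.
exists w => //; rewrite -sw; apply/eqP; rewrite -subr_eq0 -normr_le0.
apply/ler_addgt0Pr => e e0; rewrite add0r.
have E0 : 0 <= E by exact: expR_ge0.
pose C' := 2 * (C * E).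
have C'0 : 0 <= C' by rewrite !mulr_ge0.
have h n : `|Z t - step Z t| <= (C' + C' * E) / 2 ^+ n.
  rewrite -(subrKA (X n.+1 t)); apply: le_trans (ler_normD _ _) _.
  rewrite mulrDl; apply: lerD.
    apply: le_trans (ZX n.+1 t tT) _.
    rewrite ler_wpM2l// lef_pV2 ?posrE ?exprn_gt0//.
    by rewrite exprS ler_peMl ?exprn_ge0// ler1n.
  have Cn : 0 <= C' / 2 ^+ n by rewrite divr_ge0// exprn_ge0.
  have hZ s : 0 <= s <= T -> `|Z s - X n s| <= C' / 2 ^+ n * expR (lam * s).
    move=> sT; apply: le_trans (ZX n s sT) _; rewrite ler_peMr//.
    by rewrite -expR0 ler_expR mulr_ge0 ?(ltW l0)//; case/andP: sT.
  have hc := contr _ _ _ _ _ cZ (cX n) (stepP Z) (stepP (X n)) Cn hZ t tT.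
  rewrite distrC; apply: (le_trans hc); rewrite [C' * E / _]mulrAC.
  apply: ler_pM; rewrite ?expR_ge0//.
  - by rewrite divr_ge0.
  - by rewrite ler_pdivrMr// ler_peMr// ler1n.
  - by rewrite ler_expR ler_wpM2l ?(ltW l0)//; case/andP: tT.
have := @cvg_geometric R (C' + C' * E) 2^-1.
rewrite ger0_norm// invf_lt1// ltr1n => /(_ isT)/cvgr0Pnorm_lt/(_ _ e0) h2.
have [n hn] := filter_ex h2.
apply: le_trans (h n) _; apply: le_trans (ltW hn).
by rewrite /= -exprVn; exact: ler_norm.
Qed.

End Existence.

(** * Duality between state and costate *)

Section Pairing.
Context (R : realType) (V : normedModType R).
Local Notation mu := (@lebesgue_measure R).

Definition evaluation (x : V) (phi : 'L(V, R^o)) : R^o := phi x.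

Lemma evaluation_is_linear x : linear (evaluation x).
Proof. by []. Qed.

HB.instance Definition _ (x : V) :=
  GRing.isLinear.Build R 'L(V, R^o) R^o *:%R (evaluation x)
    (evaluation_is_linear x).

Lemma evaluation_continuous x : continuous (evaluation x).
Proof.
apply: bounded_linear_continuous; apply/linear_boundedP.
exists `|x|; split=> [|M xM phi]; first exact: num_real.
apply: le_trans (opnorm_ler phi x) _; rewrite mulrC.
by apply: ler_wpM2r; [exact: opnorm_ge0|exact: ltW].
Qed.

Lemma pairing_ler (phi : 'L(V, R^o)) x : `|phi x| <= `|phi| * `|x|.
Proof. exact: opnorm_ler. Qed.

Lemma measurable_pairing (D : set R) d (X : measurableType d) (E : set X)
    (h : R -> 'L(V, R^o)) (y : X -> V) (a : X -> R) :
  measurable E -> strongly_measurable D h -> measurable_fun E a ->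
  (forall w, E w -> D (a w)) ->
  (forall phi : 'L(V, R^o), measurable_fun E (fun w => phi (y w) : R)) ->
  measurable_fun E (fun w => h (a w) (y w) : R).
Proof.
move=> mE mh ma ED my.
apply: (@measurable_comp_strongly_measurable R 'L(V, R^o) D h _ _ E a
  (fun w phi => phi (y w) : R)) => //.
by move=> w _ phi; exact: (@evaluation_continuous (y w) phi).
Qed.

Lemma measurable_pairing_strongly_measurable (D : set R) (h : R -> 'L(V, R^o))
  (y : R -> V) :
  measurable D -> strongly_measurable D h -> strongly_measurable D y ->
  measurable_fun D (fun t => h t (y t) : R).
Proof.
move=> mD mh my; apply: (measurable_pairing mD mh) => // phi.
apply: (@measurable_comp_strongly_measurable R V D y _ _ D id (fun=> phi)) =>
  //.
by move=> w _; exact: bop_continuous.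
Qed.

End Pairing.

Section Duality.
Context (R : realType) (H : completeNormedModType R) (S : R -> 'L(H, H)).
Local Notation mu := (@lebesgue_measure R).
Hypothesis C0 : C0_semigroup S.
Context (T : R) (T0 : 0 < T) (g : R -> H) (h : R -> 'L(H, R^o)).
Let D : set R := `]0, T[%classic.
Let mD : measurable D. Proof. exact: measurable_itv. Qed.
Let fD : (mu D < +oo)%E. Proof. exact: lebesgue_measure_oo_lty. Qed.
Hypotheses (L1g : bochner_L1 D g) (L1h : bochner_L1 D h).

(** Its integral in the second variable is the pairing of [h] with the forced
state, its integral in the first one the pairing of the forced part of the
costate with [g]. *)
Definition duality_kernel (z : R * R) : R :=
  if (0 < z.2) && (z.2 < z.1) && (z.1 < T) then
    h z.1 (S (Num.max (z.1 - z.2) 0) (g z.2)) else 0.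
Local Notation k := duality_kernel.

Lemma duality_kernel_measurable : measurable_fun [set: R * R] k.
Proof.
pose b (z : R * R) := (0 < z.2) && (z.2 < z.1) && (z.1 < T).
have mb : measurable_fun [set: R * R] b.
  apply: measurable_and; first apply: measurable_and.
  - by apply: measurable_fun_ltr; [exact: measurable_cst|exact: measurable_snd].
  - by apply: measurable_fun_ltr; [exact: measurable_snd|exact: measurable_fst].
  - by apply: measurable_fun_ltr; [exact: measurable_fst|exact: measurable_cst].
have mE : measurable ([set: R * R] `&` b @^-1` [set true]).
  exact: mb.
apply: measurable_fun_if => //.
have b1 z : ([set: R * R] `&` b @^-1` [set true]) z -> D z.1.
  move=> [_ /andP[/andP[h1 h2] h3]]; rewrite /D /= in_itv /= h3 andbT.
  exact: lt_trans h2.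
have b2 z : ([set: R * R] `&` b @^-1` [set true]) z -> D z.2.
  move=> [_ /andP[/andP[h1 h2] h3]]; rewrite /D /= in_itv /= h1.
  exact: lt_trans h3.
apply: (measurable_pairing mE L1h.1) => //.
  by apply: measurable_funTS; exact: measurable_fst.
move=> phi.
have := @measurable_comp_strongly_measurable R H D g _ _ _ (snd : R * R -> R)
  (fun (w : R * R) x => phi (S (Num.max (w.1 - w.2) 0) x) : R) L1g.1 mE.
apply => //.
- by apply: measurable_funTS; exact: measurable_snd.
- move=> x; apply: measurable_funTS.
  have cx : continuous (fun t : R => phi (S (Num.max t 0) x) : R).
    move=> t; have ht : (s, x) @[s --> t] --> (t, x) by exact:
      (cvg_pair cvg_id (cvg_cst _)).
    have hS := cvg_comp _ _ ht (@semigroup_jointly_continuous _ _ _ C0 (t, x)).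
    exact: (cvg_comp _ _ hS (@bop_continuous _ _ _ phi _)).
  apply: (measurableT_comp (continuous_measurable_fun cx)).
  by apply: measurable_funB; [exact: measurable_fst|exact: measurable_snd].
- move=> w _ x; apply: continuous_comp; exact: bop_continuous.
Qed.

Lemma duality_kernel_integrable :
  (mu \x mu)%E.-integrable [set: R * R] (EFin \o k).
Proof.
have [M M0 SM] := semigroup_bounded C0 T.
apply/integrable12ltyP.
  by apply/measurable_EFinP; exact: duality_kernel_measurable.
have kle r s : `|k (r,
  s)| <= M * (`|h r| * (\1_D r : R)) * (`|g s| * (\1_D s : R)).
  rewrite /k /=; case: ifP => [/andP[/andP[s0 sr] rT]|_]; last first.
    by rewrite normr0 !mulr_ge0// ?ltW.
  rewrite !indicE !mem_set; last 2 first.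
  - by rewrite /D /= in_itv /= s0 (lt_trans sr).
  - by rewrite /D /= in_itv /= rT (lt_trans s0).
  rewrite !mulr1; apply: le_trans (pairing_ler _ _) _.
  rewrite [M * _]mulrC -mulrA ler_wpM2l// SM//.
  by rewrite (max_idPl _) ?subr_ge0 ?(ltW sr)//=; lra.
pose cut (V : normedModType R) (y : R -> V) s := `|y s| * (\1_D s : R).
have mcut (V : normedModType R) (y : R -> V) : bochner_L1 D y ->
  measurable_fun [set: R] (cut V y).
  move=> [my _]; rewrite [cut V y](_ : _ = (fun s => `|y s|) \_ D).
    by apply: (iffLR (measurable_restrictT _ mD)); exact:
      measurable_norm_strongly_measurable.
  apply/funext => s; rewrite /cut /patch indicE.
  by case: (s \in D); rewrite ?mulr1 ?mulr0.
have icut (V : normedModType R) (y : R -> V) :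
    (\int[mu]_s (cut V y s)%:E = \int[mu]_(s in D) `|y s|%:E)%E.
  rewrite [RHS]integral_mkcond; apply: eq_integral => s _.
  by rewrite /cut /patch indicE; case: (s \in D); rewrite ?mulr1 ?mulr0.
have cut0 (V : normedModType R) (y : R -> V) s :
  0 <= cut V y s by rewrite mulr_ge0.
have mk1 r : measurable_fun [set: R] (fun s => k (r, s)).
  apply: (measurableT_comp duality_kernel_measurable).
  exact: measurable_pair1.
pose I := (\int[mu]_(s in D) `|g s|%:E)%E.
have I0 : (0 <= I)%E by apply: integral_ge0 => s _; rewrite lee_fin.
have Ifin : I \is a fin_num by rewrite ge0_fin_numE//; exact: L1g.2.
have inner r : (\int[mu]_s `|(k (r, s))%:E| <= (M * fine I * cut _ h r)%:E)%E.
  apply: (@le_trans _ _ (\int[mu]_s ((M * cut _ h r)%:E * (cut _ g s)%:E)%E)%E).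
    apply: ge0_le_integral => //.
    - by apply: measurableT_comp => //; apply/measurable_EFinP; exact: mk1.
    - by apply: measurable_funeM; apply/measurable_EFinP; exact: mcut.
    - by move=> s _; rewrite -EFinM lee_fin; exact: kle.
  rewrite ge0_integralZl//; last 3 first.
  - by apply/measurable_EFinP; exact: mcut.
  - by move=> s _; rewrite lee_fin.
  - by rewrite lee_fin mulr_ge0 ?(ltW M0).
  by rewrite icut -/I -[I in leLHS]fineK// -EFinM lee_fin mulrAC.
apply: (@le_lt_trans _ _ (\int[mu]_r ((M * fine I)%:E * (cut _ h r)%:E)%E)%E).
  apply: ge0_le_integral => //.
  - by move=> r _; apply: integral_ge0.
  - apply: (@measurable_fun_fubini_tonelli_F _ _ _ _ _ mu (fun z =>
      `|(k z)%:E|)%E) => //.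
    apply: measurableT_comp => //; apply/measurable_EFinP.
    exact: duality_kernel_measurable.
  - by apply: measurable_funeM; apply/measurable_EFinP; exact: mcut.
  - by move=> r _; rewrite -EFinM; exact: inner.
rewrite ge0_integralZl//; last 3 first.
- by apply/measurable_EFinP; exact: mcut.
- by move=> s _; rewrite lee_fin.
- by rewrite lee_fin mulr_ge0 ?(ltW M0)// fine_ge0.
rewrite icut lte_mul_pinfty//; last exact: L1h.2.
by rewrite lee_fin mulr_ge0 ?(ltW M0)// fine_ge0.
Qed.

Context (pT : 'L(H, R^o)) (delta : R -> H) (p : R -> 'L(H, R^o)).
Hypothesis deltaP : forall t, 0 <= t <= T ->
  has_bochner_integral `]0, t[ (fun s => S (t - s) (g s)) (delta t).
Hypothesis pP : forall t, 0 <= t <= T -> exists2 v : 'L(H, R^o),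
  has_bochner_integral `]t, T[ (fun s => adj (S (s - t)) (h s)) v &
  p t = adj (S (T - t)) pT + v.

Let EFin_bochner_integral (a b : R) (y : R -> R^o) v : has_bochner_integral `]a,
  b[ y v ->
  (\int[mu]_(s in `]a, b[) (y s : R)%:E = (v : R)%:E)%E.
Proof.
move=> hv; have [yi ->] := bochner_integral_real (measurable_itv _)
  (lebesgue_measure_oo_lty a b) hv.
by rewrite /Rintegral fineK// integrable_fin_num.
Qed.

Let kernel_F r : (\int[mu]_s (k (r, s))%:E)%E =
  ((fun r => (h r (delta r) : R)%:E) \_ D) r.
Proof.
rewrite /patch; case: ifPn => [/set_mem Dr|Dr]; last first.
  rewrite integral0_eq// => s _; rewrite /k /=; case: ifP =>
    // /andP[/andP[s0 sr] rT].
  by case/negP: Dr; rewrite mem_set// /D /= in_itv /= rT (lt_trans s0).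
move: (Dr); rewrite /D /= in_itv /= => /andP[r0 rT].
have rT' : 0 <= r <= T by rewrite !ltW.
have := bochner_integral_map (measurable_itv _) (l := h r)
  (@bop_continuous _ _ _ (h r)) (deltaP rT').
move=> /EFin_bochner_integral <-; rewrite [RHS]integral_mkcond; apply:
  eq_integral => s _.
rewrite /patch /k /= rT andbT; have [st|st] := boolP (0 < s < r).
  rewrite mem_set ?in_itv//= (max_idPl _)// subr_ge0 ltW//.
  by case/andP: st.
by rewrite memNset//= in_itv; exact/negP.
Qed.

Let kernel_G s : (\int[mu]_r (k (r, s))%:E)%E =
  ((fun s => (p s (g s) - pT (S (T - s) (g s)) : R)%:E) \_ D) s.
Proof.
rewrite /patch; case: ifPn => [/set_mem Ds|Ds]; last first.
  rewrite integral0_eq// => r _; rewrite /k /=; case: ifP =>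
    // /andP[/andP[s0 sr] rT].
  by case/negP: Ds; rewrite mem_set// /D /= in_itv /= s0 (lt_trans sr).
move: (Ds); rewrite /D /= in_itv /= => /andP[s0 sT].
have sT' : 0 <= s <= T by rewrite !ltW.
have [v hv ->] := pP sT'.
have -> : (adj (S (T - s)) pT + v) (g s) - pT (S (T - s) (g s)) = v (g s).
  by rewrite -[(_ + v) _]/(pT (S (T - s) (g s)) + v (g s)) addrAC subrr add0r.
have := bochner_integral_map (measurable_itv _) (l := evaluation (g s))
  (@evaluation_continuous _ _ (g s)) hv.
move=> /EFin_bochner_integral <-; rewrite [RHS]integral_mkcond; apply:
  eq_integral => r _.
rewrite /patch /k /= s0 /=; have [st|st] := boolP (s < r < T).
  rewrite mem_set ?in_itv//= (max_idPl _)// subr_ge0 ltW//.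
  by case/andP: st.
by rewrite memNset//= in_itv; exact/negP.
Qed.

(** The two mild formulas are the two iterated integrals of one kernel over the
triangle [s < r], so Fubini's theorem turns one into the other. *)
Lemma duality :
  mu.-integrable D (EFin \o (fun s => p s (g s) : R)) ->
  mu.-integrable D (EFin \o (fun r => h r (delta r) : R)) ->
  (pT (delta T) : R) =
  \int[mu]_(s in D) (p s (g s) : R) - \int[mu]_(r in D) (h r (delta r) : R).
Proof.
move=> ip ih.
have TT : 0 <= T <= T by rewrite ltW/=.
have hT := bochner_integral_map (measurable_itv _) (l := pT)
  (@bop_continuous _ _ _ pT) (deltaP TT).
have [iT ->] := bochner_integral_real (measurable_itv _)
  (lebesgue_measure_oo_lty 0 T) hT.
have := Fubini duality_kernel_integrable.
under eq_integral do rewrite /= kernel_F.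
under [in RHS]eq_integral do rewrite /= kernel_G.
rewrite -!integral_mkcond => FE.
have -> : \int[mu]_(r in D) (h r (delta r) : R) =
    \int[mu]_(s in D) (p s (g s) - pT (S (T - s) (g s)) :
      R) by rewrite /Rintegral FE.
by rewrite RintegralB// opprB addrC subrK.
Qed.

End Duality.

(** * First variation of the state *)

Section RealIntegrals.
Context (R : realType) (T : R).
Local Notation mu := (@lebesgue_measure R).
Hypothesis T0 : 0 < T.
Let D : set R := `]0, T[%classic.
Let mD : measurable D. Proof. exact: measurable_itv. Qed.
Let fD : (mu D < +oo)%E. Proof. exact: lebesgue_measure_oo_lty. Qed.
Local Notation int f := (mu.-integrable D (EFin \o (f : R -> R))).

Lemma integrable_ae_bounded (f : R -> R) (C : R) : measurable_fun D f ->
  {ae mu, forall t, D t -> `|f t| <= C} -> int f.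
Proof.
move=> mf fC; apply/integrableP; split; first by apply/measurable_EFinP.
have [_] := bochner_L1_bounded mD fD
  (strongly_measurable_of_measurable mD fD mf) fC.
exact.
Qed.

Lemma integrable_ae_boundedM (f e : R -> R) (K C : R) : measurable_fun D f ->
  {ae mu, forall t, D t -> `|f t| <= K} -> measurable_fun D e ->
  {ae mu, forall t, D t -> `|e t| <= C} -> int (fun t => f t * e t).
Proof.
move=> mf fK me eC; apply: (@integrable_ae_bounded _ (K * C)).
  exact: measurable_funM.
apply: ae_mono (ae_and fK eC) => t [h1 h2] Dt.
by rewrite normrM ler_pM ?h1 ?h2.
Qed.

Lemma integrable_addR (f e : R -> R) : int f -> int e ->
  int (fun t => f t + e t).
Proof. by move=> hf he; exact: (@integrableD _ _ _ mu D mD _ _ hf he). Qed.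

Lemma integrable_scaleR (k : R) (f : R -> R) : int f -> int (fun t => k * f t).
Proof.
move=> hf; have := @integrableZl _ _ _ mu D mD k _ hf.
by apply: eq_integrable => // t _; rewrite /= EFinM.
Qed.

Lemma Rintegral_le_bound (f : R -> R) (C : R) : int f ->
  (forall t, D t -> f t <= C) -> \int[mu]_(t in D) f t <= C * T.
Proof.
move=> hf fC; apply: (@le_trans _ _ (\int[mu]_(t in D) C)).
  apply: le_Rintegral => //.
  apply: (@integrable_ae_bounded _ `|C|); first exact: measurable_cst.
  exact: aeW.
rewrite Rintegral_cst//.
have -> : fine (mu D) = T.
  by rewrite /D lebesgue_measure_itv /= lte_fin T0 -EFinB subr0.
by [].
Qed.

End RealIntegrals.

Section Variation.
Context (R : realType) (H : completeNormedModType R) (S : R -> 'L(H, H)).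
Local Notation mu := (@lebesgue_measure R).
Hypothesis C0 : C0_semigroup S.
Context (T : R) (T0 : 0 < T) (f : R -> H) (B1 : H) (B2 : 'L(H, H)) (Psi0 : H).
Let D : set R := `]0, T[%classic.
Let mD : measurable D. Proof. exact: measurable_itv. Qed.
Let fD : (mu D < +oo)%E. Proof. exact: lebesgue_measure_oo_lty. Qed.
Local Notation int f := (mu.-integrable D (EFin \o (f : R -> R))).
Let D0 s : D s -> 0 <= s. Proof. by rewrite /D /= in_itv /= => /andP[/ltW]. Qed.
Let DT s : D s -> 0 <= s <= T.
Proof. by rewrite /D /= in_itv /= => /andP[/ltW-> /ltW->]. Qed.

Context (u w : R -> R) (K : R) (Psi : R -> H).
Hypotheses (K0 : 0 <= K) (w1 : forall t, `|w t| <= 1).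
Hypothesis PsiP : mild_state T S f B1 B2 Psi0 u Psi.

Let PsiC : {within `[0, T], continuous Psi}. Proof. by case: PsiP. Qed.

(** The difference is multiplied by the perturbed control, which obeys the same
bound as the unperturbed one; the remaining term is of order [e] and involves
the unperturbed state only. *)
Definition variation_source (e : R) (Psi' : R -> H) (s : R) : H :=
  (u s + e * w s) *: B2 (Psi' s - Psi s) + (e * w s) *: (B1 + B2 (Psi s)).

(** Subtracting the two mild equations removes the initial state and the force
[f]. *)
Lemma state_variation_mild e Psi' :
  mild_state T S f B1 B2 Psi0 (fun t => u t + e * w t) Psi' ->
  forall t, 0 <= t <= T -> has_bochner_integral `]0, t[
    (fun s => S (t - s) (variation_source e Psi' s)) (Psi' t - Psi t).
Proof.
move=> [_ P'] t tT; have tT' : t \in `[0, T] by rewrite in_itv.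
have [v' hv' ->] := P' t tT'; have [v hv ->] := PsiP.2 t tT'.
rewrite opprD addrACA subrr add0r.
have := bochner_integral_sub (measurable_itv _) hv' hv; apply:
  bochner_integral_ext => s _.
rewrite -(linearB (S (t - s))) opprD addrACA subrr add0r; congr (S _ _).
rewrite /variation_source.
have -> : B2 (Psi' s - Psi s) = (B1 + B2 (Psi' s)) - (B1 + B2 (Psi s)).
  by rewrite opprD addrACA subrr add0r linearB.
by rewrite scalerBr [X in _ - X + _]scalerDl opprD addrA subrK.
Qed.

(** Gronwall's inequality. The constant depends on the unperturbed state only,
which makes the quadratic terms of the cost uniformly of second order. *)
Lemma variation_bound : exists2 C : R, 0 <= C & forall e Psi', 0 <= e ->
  mild_state T S f B1 B2 Psi0 (fun t => u t + e * w t) Psi' ->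
  {ae mu, forall t, D t -> `|u t + e * w t| <= K} ->
  forall t, 0 <= t <= T -> `|Psi' t - Psi t| <= e * C.
Proof.
have [M M0 SM] := semigroup_bounded C0 T.
have [CP CP0 PsiB] := continuous_itv_bounded (ltW T0) PsiC.
pose L := M * (K * opnorm B2).
have L0 : 0 <= L by rewrite !mulr_ge0 ?opnorm_ge0// ltW.
pose lam := 2 * L + 1; have l0 : 0 < lam by rewrite /lam; lra.
pose a := `|B1| + opnorm B2 * CP.
have a0 : 0 <= a by rewrite addr_ge0// mulr_ge0 ?opnorm_ge0.
exists (2 * (M * a * T) * expR (lam * T)).
  by rewrite !mulr_ge0 ?expR_ge0 ?(ltW M0) ?(ltW T0).
move=> e Psi' e0 P' uK t tT.
rewrite [leRHS](_ : _ = 2 * (M * (e * a) * T) * expR (lam * T)); last by ring.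
apply: (weighted_gronwall (d := fun t => `|Psi' t - Psi t|) (ltW T0)
  (ltW l0)) => //.
  have h : {within `[0, T], continuous (fun t => Psi' t - Psi t)}.
    by move=> s; apply: cvgB; [exact: (P'.1 s)|exact: PsiC].
  by move=> s; exact: (cvg_comp _ _ (h s)
    (@norm_continuous _ _ (Psi' s - Psi s))).
move=> c c0 dc s sT; have /andP[s0 _] := sT.
apply: (@le_trans _ _ (M * (e * a) * s + (L * c) / lam * expR (lam * s))).
  apply: (bochner_integral_exp_le _ _ l0 s0 (state_variation_mild P' sT)).
  - by rewrite !mulr_ge0// ltW.
  - exact: mulr_ge0.
  - apply: ae_mono uK => r ur rs.
    have Dr : D r.
      by move: rs sT; rewrite /D /= !in_itv /= => /andP[-> rs] /andP[_]; exact: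
        lt_le_trans.
    have rs0 : 0 <= s - r <= T.
      move: rs sT; rewrite /= in_itv /= => /andP[h1 h2] /andP[h3 h4].
      by rewrite subr_ge0 ltW//=; lra.
    apply: le_trans (SM _ _ rs0) _; rewrite /L -!mulrA -mulrDr ler_pM2l//.
    rewrite /variation_source addrC; apply: le_trans (ler_normD _ _) _; apply:
      lerD.
      rewrite normrZ normrM (ger0_norm e0) -mulrA ler_wpM2l// -[leRHS]mul1r.
      apply: ler_pM => //; apply: le_trans (ler_normD _ _) _; rewrite lerD2l.
      apply: le_trans (opnorm_ler _ _) _.
      by rewrite ler_wpM2l ?opnorm_ge0// PsiB// DT.
    rewrite normrZ ler_pM ?ur//; apply: le_trans (opnorm_ler _ _) _.
    by rewrite ler_wpM2l ?opnorm_ge0// dc// DT.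
apply: lerD.
  by rewrite ler_wpM2l ?mulr_ge0 ?(ltW M0)//; case/andP: sT.
rewrite ler_wpM2r ?expR_ge0// mulrAC mulrC ler_wpM2l//.
by rewrite ler_pdivrMr// /lam; lra.
Qed.

End Variation.

(** * First variation of the cost *)

Lemma bop_ler (R : realType) (V W : normedModType R) (l : 'L(V, W)) (x : V)
  (B : R) :
  `|x| <= B -> `|l x| <= opnorm l * B.
Proof.
by move=> xB; apply: le_trans (opnorm_ler _ _) _;
  rewrite ler_wpM2l// opnorm_ge0.
Qed.

Lemma bilinear_ler (R : realType) (V : normedModType R) (Q : 'L(V, 'L(V, R^o)))
    (x y : V) (A B : R) : `|x| <= A -> `|y| <= B ->
      `|Q x y| <= opnorm Q * A * B.
Proof.
move=> xA yB; apply: le_trans (pairing_ler _ _) _; apply: ler_pM => //.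
exact: bop_ler.
Qed.

(** Symmetry merges the two cross terms, so that the costate equation sees
exactly the derivative of the quadratic form. *)
Lemma symmetric_form_expand (R : realType) (V : normedModType R)
    (Q : 'L(V, 'L(V, R^o))) (x y : V) : (forall x y, Q x y = Q y x) ->
  (Q (x + y) (x + y) : R) = Q x x + (2 * (Q x y : R) + Q y y).
Proof.
move=> Qsym; rewrite (linearD Q) -[LHS]/((Q x (x + y) : R) + Q y (x + y)).
have -> : Q x (x + y) = Q x x + Q x y by exact: linearD.
have -> : Q y (x + y) = Q x y + Q y y by rewrite (Qsym x y); exact: linearD.
rewrite -[LHS]/(((Q x x : R) + Q x y) + ((Q x y : R) + Q y y)); ring.
Qed.

Lemma bochner_L1_ext (R : realType) (V : normedModType R) (D : set R)
  (f g : R -> V) :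
  (forall t, D t -> f t = g t) -> bochner_L1 D f -> bochner_L1 D g.
Proof.
move=> fg [mf If]; split; first exact: strongly_measurable_ext mf.
apply: le_lt_trans If; rewrite le_eqVlt; apply/orP; left; apply/eqP.
by apply: eq_integral => t; rewrite inE => /fg ->.
Qed.

Section FirstVariation.
Context (R : realType) (H : completeNormedModType R) (S : R -> 'L(H, H)).
Local Notation mu := (@lebesgue_measure R).
Hypothesis C0 : C0_semigroup S.
Context (T : R) (T0 : 0 < T) (f : R -> H) (B1 : H) (B2 : 'L(H, H)) (Psi0 : H).
Context (Q QT : 'L(H, 'L(H, R^o))) (Psid : R -> H) (PsidT : H) (alpha : R).
Let D : set R := `]0, T[%classic.
Let mD : measurable D. Proof. exact: measurable_itv. Qed.
Let fD : (mu D < +oo)%E. Proof. exact: lebesgue_measure_oo_lty. Qed.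
Local Notation int f := (mu.-integrable D (EFin \o (f : R -> R))).
Let D0 s : D s -> 0 <= s. Proof. by rewrite /D /= in_itv /= => /andP[/ltW]. Qed.
Let DT s : D s -> 0 <= s <= T.
Proof. by rewrite /D /= in_itv /= => /andP[/ltW-> /ltW->]. Qed.

Context (u w : R -> R) (K : R) (Psi : R -> H) (p : R -> 'L(H, R^o)).
Hypotheses (Qsym : forall x y, Q x y = Q y x)
  (QTsym : forall x y, QT x y = QT y x).
Hypotheses (K0 : 0 <= K) (meas_u : measurable_fun D u)
  (mw : measurable_fun D w).
Hypothesis uK : {ae mu, forall t, D t -> `|u t| <= K}.
Hypothesis w1 : forall t, `|w t| <= 1.
Hypothesis PsiP : mild_state T S f B1 B2 Psi0 u Psi.
Hypothesis PsidP : bochner_Linfty D Psid.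
Hypothesis pP : mild_costate T S B2 Q QT Psid PsidT u Psi p.

Lemma strongly_measurable_within (V : normedModType R) (y : R -> V) :
  {within `[0, T], continuous y} -> strongly_measurable D y.
Proof.
move=> cy; have := strongly_measurable_continuous mD fD D0
  (continuous_comp_clamp (ltW T0) cy).
by apply: strongly_measurable_ext => t Dt /=; rewrite clamp_id// DT.
Qed.

Let L1_scale_within (V : normedModType R) (v : R -> R) (A : R) (y : R -> V) :
  measurable_fun D v -> {ae mu, forall t, D t -> `|v t| <= A} ->
  {within `[0, T], continuous y} -> bochner_L1 D (fun t => v t *: y t).
Proof.
move=> mv vA cy.
have := bochner_L1_scale T0 mv vA (continuous_comp_clamp (ltW T0) cy).
by apply: bochner_L1_ext => t Dt /=; rewrite clamp_id// DT.
Qed.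

Let within_bop (V W : normedModType R) (l : 'L(V, W)) (y : R -> V) :
  {within `[0, T], continuous y} ->
    {within `[0, T], continuous (fun t => l (y t))}.
Proof. by move=> cy t; exact:
  (cvg_comp _ _ (cy t) (@bop_continuous _ _ _ l (y t))). Qed.

Let cPsi : {within `[0, T], continuous Psi}. Proof. by case: PsiP. Qed.
Let cp : {within `[0, T], continuous p}. Proof. by case: pP. Qed.
Let cB : {within `[0, T], continuous (fun t => B1 + B2 (Psi t))}.
Proof.
move=> t; apply: cvgD; [exact: cvg_cst|exact: (within_bop cPsi)].
Qed.

Let h t := Q (Psi t - Psid t) + u t *: adj B2 (p t).

Let PsidB : exists2 A : R, 0 <= A &
  {ae mu, forall t, D t -> `|Psi t - Psid t| <= A}.
Proof.
have [_ [Md PdM]] := PsidP.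
have [CP CP0 PsiB] := continuous_itv_bounded (ltW T0) cPsi.
exists (CP + `|Md|); first by rewrite addr_ge0.
apply: ae_mono PdM => t hd Dt; apply: le_trans (ler_normB _ _) _.
by rewrite lerD ?PsiB ?DT// (le_trans (hd Dt))// ler_norm.
Qed.

Let strongly_measurable_gap : strongly_measurable D (fun t => Psi t - Psid t).
Proof. by apply: strongly_measurable_sub;
  [exact: strongly_measurable_within|case: PsidP]. Qed.

Let L1h : bochner_L1 D h.
Proof.
have [A A0 PA] := PsidB.
apply: bochner_L1_add => //; last by apply: L1_scale_within uK _ => //; exact:
  within_bop.
apply: (bochner_L1_bounded mD fD (C := opnorm Q * A)).
  by apply: (strongly_measurable_map (l := Q)) strongly_measurable_gap; exact:
    bop_continuous.
by apply: ae_mono PA => t hA Dt; apply: bop_ler; exact: hA.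
Qed.

(** The terms that are linear in the difference of the states cancel, by
[duality], against the terminal term, and leave the switching function; each of
the others is a product of two factors of order [e]. *)
Lemma first_variation : exists2 C : R, 0 <= C & forall e Psi', 0 <= e ->
  mild_state T S f B1 B2 Psi0 (fun t => u t + e * w t) Psi' ->
  {ae mu, forall t, D t -> `|u t + e * w t| <= K} ->
  cost T alpha Q QT Psid PsidT (fun t => u t + e * w t) Psi' -
    cost T alpha Q QT Psid PsidT u Psi <=
  e * \int[mu]_(t in D) (w t * (alpha + p t (B1 + B2 (Psi t)))) + e ^+ 2 * C.
Proof.
have [C C_0 dC] := variation_bound C0 T0 K0 w1 PsiP.
have [Cp Cp0 pB] := continuous_itv_bounded (ltW T0) cp.
have [CB CB0 BB] := continuous_itv_bounded (ltW T0) cB.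
have [A A0 PA] := PsidB.
pose c1 := Cp * (opnorm B2 * C) * T.
pose c2 := opnorm Q * C * C * T.
pose c3 := opnorm QT * C * C.
have c10 : 0 <= c1 by rewrite !mulr_ge0 ?opnorm_ge0// ltW.
have c20 : 0 <= c2 by rewrite !mulr_ge0 ?opnorm_ge0// ltW.
have c30 : 0 <= c3 by rewrite !mulr_ge0 ?opnorm_ge0.
exists (c1 + 2^-1 * c2 + 2^-1 * c3); first by
  apply: addr_ge0; [apply: addr_ge0 => //|]; apply: mulr_ge0.
move=> e Psi' e0 P' vK.
have cPsi' : {within `[0, T], continuous Psi'} by case: P'.
pose d t := Psi' t - Psi t.
have cd : {within `[0, T], continuous d}.
  by move=> t; apply: cvgB; [exact: (cPsi' t)|exact: cPsi].
have dB t : 0 <= t <= T -> `|d t| <= e * C by move=> tT; exact: (dC e Psi').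
pose g := variation_source B1 B2 u w Psi e Psi'.
have mv : measurable_fun D (fun t => u t + e * w t).
  by apply: measurable_funD => //; exact: measurable_funM.
have mew : measurable_fun D (fun t => e * w t) by exact: measurable_funM.
have L1g : bochner_L1 D g.
  apply: bochner_L1_add => //.
    by apply: (L1_scale_within mv vK); exact: (within_bop cd).
  apply: (L1_scale_within (A := e) mew _ cB).
  by apply: aeW => t _; rewrite normrM (ger0_norm e0) ler_piMr.
pose e1 t : R := p t (B2 (d t)).
pose e2 t : R := p t (B1 + B2 (Psi t)).
pose qd t : R := Q (Psi t - Psid t) (d t).
pose qdd t : R := Q (d t) (d t).
pose qa t : R := Q (Psi t - Psid t) (Psi t - Psid t).
have smp := strongly_measurable_within cp;
  have smd := strongly_measurable_within cd.
have me1 : measurable_fun D e1.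
  by apply: measurable_pairing_strongly_measurable => //; apply:
    strongly_measurable_within; exact: (within_bop cd).
have me2 : measurable_fun D e2.
  by apply: measurable_pairing_strongly_measurable => //; exact:
    strongly_measurable_within.
have smQ (y : R -> H) : strongly_measurable D y ->
  strongly_measurable D (fun t => Q (y t)).
  by move=> my; apply: (strongly_measurable_map (l := Q)) my; exact:
    bop_continuous.
have mqd : measurable_fun D qd by apply:
  measurable_pairing_strongly_measurable => //; exact: smQ.
have mqdd : measurable_fun D qdd by apply:
  measurable_pairing_strongly_measurable => //; exact: smQ.
have mqa : measurable_fun D qa by apply:
  measurable_pairing_strongly_measurable => //; exact: smQ.
have e1B t : D t -> `|e1 t| <= Cp * (opnorm B2 * (e * C)).
  move=> Dt; apply: le_trans (pairing_ler _ _) _; apply: ler_pM => //.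
    by apply: pB; exact: DT.
  by apply: bop_ler; apply: dB; exact: DT.
have e2B t : D t -> `|e2 t| <= Cp * CB.
  move=> Dt; apply: le_trans (pairing_ler _ _) _.
  by apply: ler_pM => //; [apply: pB|apply: BB]; exact: DT.
have qddB t : 0 <= t <= T -> `|Q (d t) (d t)| <= opnorm Q * (e * C) * (e * C).
  by move=> tT; apply: bilinear_ler; exact: dB.
have w1ae : {ae mu, forall t, D t -> `|w t| <= 1} by exact: aeW.
have iw : int w by exact: integrable_ae_bounded w1ae.
have iu : int u by exact: integrable_ae_bounded uK.
have iqa : int qa.
  apply: (integrable_ae_bounded mqa (C := opnorm Q * A * A)).
  by apply: ae_mono PA => t hA Dt; apply: bilinear_ler; exact: hA.
have iqd : int qd.
  apply: (integrable_ae_bounded mqd (C := opnorm Q * A * (e * C))).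
  apply: ae_mono PA => t hA Dt; apply: bilinear_ler; first exact: hA.
  by apply: dB; exact: DT.
have iqdd : int qdd.
  apply: (integrable_ae_bounded mqdd (C := opnorm Q * (e * C) * (e * C))).
  by apply: aeW => t Dt; apply: qddB; exact: DT.
have iue1 : int (fun t => u t * e1 t).
  by apply: (integrable_ae_boundedM meas_u uK me1); apply: aeW => t Dt; exact:
    e1B.
have iwe1 : int (fun t => w t * e1 t).
  by apply: (integrable_ae_boundedM mw w1ae me1); apply: aeW => t Dt; exact:
    e1B.
have iwe2 : int (fun t => w t * e2 t).
  by apply: (integrable_ae_boundedM mw w1ae me2); apply: aeW => t Dt; exact:
    e2B.
have I1 : \int[mu]_(t in D) (u t + e * w t) =
    \int[mu]_(t in D) u t + e * \int[mu]_(t in D) w t.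
  by rewrite RintegralD ?RintegralZl//; exact: integrable_scaleR.
have I2 : \int[mu]_(t in D) (Q (Psi' t - Psid t) (Psi' t - Psid t) : R) =
    \int[mu]_(t in D) qa t +
      (2 * \int[mu]_(t in D) qd t + \int[mu]_(t in D) qdd t).
  rewrite -RintegralZl// -RintegralD//; last exact: integrable_scaleR.
  rewrite -RintegralD//; last by apply: integrable_addR => //; exact:
    integrable_scaleR.
  apply: eq_Rintegral => t _; rewrite /qa /qd /qdd.
  have -> : Psi' t - Psid t = (Psi t - Psid t) + d t.
    by rewrite /d [RHS]addrC addrA subrK.
  exact: symmetric_form_expand.
have I3 : (QT (Psi' T - PsidT) (Psi' T - PsidT) : R) =
   QT (Psi T - PsidT) (Psi T - PsidT) + (2 * (p T (d T) : R) + QT (d T) (d T)).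
  have [_ -> _] := pP; rewrite -symmetric_form_expand//.
  have -> : Psi' T - PsidT = (Psi T - PsidT) + d T.
    by rewrite /d [RHS]addrC addrA subrK.
  by [].
(* the control times [p t (B2 (d t))] occurs in both integrals of the duality *)
have I4 : (p T (d T) : R) = e * \int[mu]_(t in D) (w t * e1 t) +
    e * \int[mu]_(t in D) (w t * e2 t) - \int[mu]_(t in D) qd t.
  have pgE t : (p t (g t) :
    R) = (u t * e1 t + e * (w t * e1 t)) + e * (w t * e2 t).
    rewrite /g /variation_source linearD !linearZ /=.
    rewrite -[LHS]/((u t + e * w t) * e1 t + (e * w t) * e2 t); ring.
  have hdE t : (h t (d t) : R) = qd t + u t * e1 t by [].
  have ipg : int (fun t => p t (g t)).
    under eq_fun do rewrite pgE.
    apply: integrable_addR; last exact: integrable_scaleR.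
    by apply: integrable_addR => //; exact: integrable_scaleR.
  have ihd : int (fun t => h t (d t)).
    by under eq_fun do rewrite hdE; exact: integrable_addR.
  have hP t : 0 <= t <= T -> exists2 v : 'L(H, R^o),
      has_bochner_integral `]t, T[ (fun s => adj (S (s - t)) (h s)) v &
      p t = adj (S (T - t)) (p T) + v.
    by move=> tT; have [_ _ /(_ t)] := pP; rewrite in_itv; apply.
  rewrite (duality C0 T0 L1g L1h (state_variation_mild PsiP P') hP ipg ihd).
  rewrite -RintegralB// -!RintegralZl// -RintegralD//; try exact:
    integrable_scaleR.
  rewrite -RintegralB//; last by apply: integrable_addR; exact:
    integrable_scaleR.
  by apply: eq_Rintegral => t _; rewrite pgE hdE; ring.
have I5 : \int[mu]_(t in D) (w t * (alpha + p t (B1 + B2 (Psi t)))) =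
    alpha * \int[mu]_(t in D) w t + \int[mu]_(t in D) (w t * e2 t).
  rewrite -RintegralZl// -RintegralD//; last exact: integrable_scaleR.
  by apply: eq_Rintegral => t _; rewrite mulrDr [alpha * _]mulrC.
have b1 : \int[mu]_(t in D) (w t * e1 t) <= e * c1.
  have -> : e * c1 = (Cp * (opnorm B2 * (e * C))) * T by rewrite /c1; ring.
  apply: Rintegral_le_bound => // t Dt; apply: le_trans (ler_norm _) _.
  rewrite normrM -[leRHS]mul1r; apply: ler_pM => //; exact: e1B.
have b2 : \int[mu]_(t in D) qdd t <= e ^+ 2 * c2.
  have -> : e ^+ 2 * c2 = (opnorm Q * (e * C) * (e * C)) * T by rewrite /c2;
    ring.
  apply: Rintegral_le_bound => // t Dt; apply: le_trans (ler_norm _) _.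
  by apply: qddB; exact: DT.
have b3 : (QT (d T) (d T) : R) <= e ^+ 2 * c3.
  have -> : e ^+ 2 * c3 = opnorm QT * (e * C) * (e * C) by rewrite /c3; ring.
  apply: le_trans (ler_norm _) _.
  by apply: bilinear_ler; apply: dB; rewrite lexx ltW.
rewrite /cost I1 I2 I3 I4 I5.
have b1' : e * \int[mu]_(t in D)
  (w t * e1 t) <= e * (e * c1) by rewrite ler_wpM2l.
rewrite -/qa; lra.
Qed.

End FirstVariation.

(** * Weak minima *)

Section WeakMinimum.
Context (R : realType) (H : completeNormedModType R) (S : R -> 'L(H, H)).
Local Notation mu := (@lebesgue_measure R).
Hypothesis C0 : C0_semigroup S.
Context (T : R) (T0 : 0 < T) (f : R -> H) (B1 : H) (B2 : 'L(H, H)) (Psi0 : H).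
Context (Q QT : 'L(H, 'L(H, R^o))) (Psid : R -> H) (PsidT : H)
  (alpha um uM : R).
Let D : set R := `]0, T[%classic.
Let mD : measurable D. Proof. exact: measurable_itv. Qed.
Let fD : (mu D < +oo)%E. Proof. exact: lebesgue_measure_oo_lty. Qed.
Local Notation int f := (mu.-integrable D (EFin \o (f : R -> R))).
Let DT s : D s -> 0 <= s <= T.
Proof. by rewrite /D /= in_itv /= => /andP[/ltW-> /ltW->]. Qed.

Let K := Num.max `|um| `|uM|.
Let K0 : 0 <= K. Proof. by rewrite le_max normr_ge0. Qed.

Lemma admissible_measurable v : admissible T um uM v -> measurable_fun D v.
Proof. by case=> /measurable_int/measurable_EFinP. Qed.

Lemma admissible_bounded v : admissible T um uM v ->
  {ae mu, forall t, D t -> `|v t| <= K}.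
Proof.
case=> _; apply: ae_mono => t hv /hv /andP[h1 h2].
rewrite ler_norml /K; apply/andP; split.
- rewrite lerNl le_max; apply/orP; left; have := ler_norm (- um).
  by rewrite normrN; lra.
- by rewrite le_max; apply/orP; right; apply: le_trans h2 _; exact: ler_norm.
Qed.

Lemma state_mild v : bochner_L1 D f -> admissible T um uM v ->
  mild_state T S f B1 B2 Psi0 v (state T S f B1 B2 Psi0 v).
Proof.
move=> L1f av.
have ex := mild_state_exists C0 T0 L1f B1 B2 Psi0 (admissible_measurable av) K0
  (admissible_bounded av).
exact: (xgetPex (cst 0) ex).
Qed.

Context (u : R -> R) (p : R -> 'L(H, R^o)).
Hypotheses (L1f : bochner_L1 D f).
Hypotheses (Qsym : forall x y, Q x y = Q y x)
  (QTsym : forall x y, QT x y = QT y x).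
Hypothesis PsidP : bochner_Linfty D Psid.
Let Psi_ := state T S f B1 B2 Psi0.
Hypothesis umin :
  weak_minimum T um uM (fun v => cost T alpha Q QT Psid PsidT v (Psi_ v)) u.
Hypothesis pP : mild_costate T S B2 Q QT Psid PsidT u (Psi_ u) p.
Let Lambda t : R := alpha + p t (B1 + B2 (Psi_ u t)).

Let au : admissible T um uM u. Proof. by case: umin. Qed.

Lemma switching_measurable : measurable_fun D Lambda.
Proof.
have [cPsi _] := state_mild L1f au; have [cp _ _] := pP.
apply: measurable_funD; first exact: measurable_cst.
apply: measurable_pairing_strongly_measurable => //; apply:
  (strongly_measurable_within T0) => // t.
apply: cvgD; first exact: cvg_cst.
exact: (cvg_comp _ _ (cPsi t) (@bop_continuous _ _ _ B2 (Psi_ u t))).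
Qed.

Lemma switching_bounded : exists C, forall t, D t -> `|Lambda t| <= C.
Proof.
have [cPsi _] := state_mild L1f au; have [cp _ _] := pP.
have [A A0 PA] := continuous_itv_bounded (ltW T0) cPsi.
have [B B0 pB] := continuous_itv_bounded (ltW T0) cp.
exists (`|alpha| + B * (`|B1| + opnorm B2 * A)) => t /DT tT.
apply: le_trans (ler_normD _ _) _; rewrite lerD2l.
apply: le_trans (pairing_ler _ _) _; apply: ler_pM => //; first exact: pB.
apply: le_trans (ler_normD _ _) _; rewrite lerD2l.
by apply: bop_ler; exact: PA.
Qed.

Lemma Lnorm_perturbation_lt (v w : R -> R) (e d : R) : 0 <= e -> e < d ->
  (forall t, `|w t| <= 1) -> (forall t, v t = u t + e * w t) ->
  ('N[mu]_+oo[EFin \o ((v \- u) \_ `]0, T[%classic)%R] < d%:E)%E.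
Proof.
move=> e0 ed w1 vE; rewrite unlock /Lnorm.body /=.
case: ifPn => _; last by rewrite lte_fin (le_lt_trans e0).
apply: (@le_lt_trans _ _ e%:E); last by rewrite lte_fin.
apply/ess_supP; apply: aeW => t /=; rewrite lee_fin /patch.
case: ifPn => _; last by rewrite normr0.
have -> : (v \- u) t = e * w t.
  by rewrite -[LHS]/(v t - u t) vE addrAC subrr add0r.
by rewrite normrM (ger0_norm e0) ler_piMr.
Qed.

(** A negative first-order term would dominate the remainder for small
perturbations. *)
Lemma weak_minimum_direction (w : R -> R) (eta : R) : 0 < eta ->
  measurable_fun D w -> (forall t, `|w t| <= 1) ->
  (forall e, 0 < e < eta -> admissible T um uM (fun t => u t + e * w t)) ->
  0 <= \int[mu]_(t in D) (w t * Lambda t).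
Proof.
move=> eta0 mw w1 aw.
have [_ [d d0 minF]] := umin.
have [C C_0 var] := first_variation C0 T0 alpha Qsym QTsym K0
  (admissible_measurable au) mw (admissible_bounded au) w1 (state_mild L1f au)
    PsidP pP.
set I := \int[mu]_(t in D) _ in var *.
have key e : 0 < e -> e < eta -> e < d -> 0 <= e * I + e ^+ 2 * C.
  move=> e0 e_eta ed.
  have ae : admissible T um uM (fun t => u t + e * w t) by apply: aw;
    rewrite e0.
  apply: le_trans (var e _ (ltW e0) (state_mild L1f ae)
    (admissible_bounded ae)).
  rewrite subr_ge0; apply: minF => //.
  by apply: (Lnorm_perturbation_lt (w := w) (ltW e0)).
rewrite leNgt; apply/negP => I0.
(* for [e = m / 2] the factor [I + e * C] is still negative *)
pose m := Num.min (Num.min eta d) (- I / (C + 1)).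
have C1 : 0 < C + 1 by rewrite ltr_pwDr.
have m0 : 0 < m by rewrite /m !lt_min eta0 d0 divr_gt0// oppr_gt0.
have [m1 [m2 m3]] : m <= eta /\ m <= d /\ m * (C + 1) <= - I.
  by rewrite -ler_pdivlMr// /m !ge_min !lexx ?orbT.
have := key (m / 2); rewrite divr_gt0//.
have h1 : m / 2 < eta by lra.
have h2 : m / 2 < d by lra.
move=> /(_ isT h1 h2).
have -> : m / 2 * I + (m / 2) ^+ 2 * C = (m / 2) * (I + m / 2 * C) by ring.
by rewrite pmulr_rge0 ?divr_gt0//; nra.
Qed.

(** On such a set a step of length less than [c] in direction [sg] is
admissible and, unless the set is null, lowers the cost to first order. *)
Lemma weak_minimum_null (E : set R) (sg c : R) : measurable E -> E `<=` D ->
  0 < c -> `|sg| <= 1 -> (forall t, E t -> sg * Lambda t <= - c) ->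
  (forall t, E t -> um <= u t <= uM -> um <= u t + c * sg <= uM) ->
  mu E = 0%E.
Proof.
move=> mE ED c0 sg1 EL Eu.
pose w t : R := sg * (\1_E t : R).
have mw : measurable_fun D w.
  apply: measurable_funM; first exact: measurable_cst.
  exact: measurable_indic.
have w1 t : `|w t| <= 1.
  by rewrite /w indicE; case: (_ \in _); rewrite ?mulr1 // mulr0 normr0.
have aw e : 0 < e < c -> admissible T um uM (fun t => u t + e * w t).
  move=> /andP[e0 ec]; have [iu bu] := au; split.
    apply: integrable_addR => //; apply: integrable_scaleR.
    by apply: (integrable_ae_bounded mw (C := 1)); exact: aeW.
  apply: ae_mono bu => t hu Dt; have hut := hu Dt; rewrite /w indicE.
  have [/set_mem Et|_] := boolP (t \in E); last by rewrite !mulr0 addr0.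
  have := Eu _ Et hut; move: hut => /andP[h1 h2] /andP[h3 h4].
  rewrite mulr1; apply/andP; split.
  - have [s0|s0] := leP 0 sg;
      first by rewrite (le_trans h1)// lerDl mulr_ge0// ltW.
    by apply: (le_trans h3); rewrite lerD2l ler_nM2r// ltW.
  - have [s0|s0] := leP 0 sg;
      last by rewrite (le_trans _ h2)// gerDl mulr_ge0_le0// ltW.
    by apply: le_trans h4; rewrite lerD2l ler_wpM2r// ltW.
have := weak_minimum_direction c0 mw w1 aw.
have [C LC] := switching_bounded.
have iw1 : int (\1_E : R -> R).
  apply: (integrable_ae_bounded (C := 1)); first exact: measurable_indic.
  by apply: aeW => t _; rewrite indicE; case: (_ \in _);
    rewrite ?normr1 ?normr0.
have le : \int[mu]_(t in D) (w t * Lambda t) <= \int[mu]_(t in D)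
  (- c * (\1_E t : R)).
  apply: le_Rintegral => //.
  - apply: (integrable_ae_boundedM mw (K := 1) (C := C)).
    + by apply: aeW => t _.
    + exact: switching_measurable.
    + by apply: aeW => t Dt; exact: LC.
  - exact: integrable_scaleR.
  - move=> t Dt; rewrite /w indicE; have [/set_mem Et|_] := boolP (t \in E).
      by rewrite !mulr1; exact: EL.
    by rewrite !mulr0 mul0r.
move=> /le_trans/(_ le); rewrite RintegralZl// mulNr oppr_ge0 pmulr_rle0//.
have -> : \int[mu]_(t in D) (\1_E t : R) = fine (mu E).
  by rewrite /Rintegral integral_indic// (setIidl ED).
move=> h; have fE : mu E \is a fin_num.
  rewrite ge0_fin_numE//; apply: le_lt_trans fD; apply: le_measure;
    rewrite ?inE//.
rewrite -[LHS]fineK//; congr EFin; apply/eqP.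
by rewrite eq_le h fine_ge0.
Qed.

(** The pairs [sg], [b] of interest are [-1], [um] and [1], [uM]: the
perturbation pushes the control towards the bound [b]. Countably many sets on
which [Lambda] and the slack are bounded away from zero exhaust the exceptional
set. *)
Lemma weak_minimum_negligible (sg : R) (b : R) : `|sg| <= 1 ->
  (forall t c, 0 < c -> um <= u t <= uM -> c <= sg * (b - u t) ->
     um <= u t + c * sg <= uM) ->
  (forall t, um <= u t <= uM -> 0 <= sg * (b - u t)) ->
  mu.-negligible [set t | D t /\ sg * Lambda t < 0 /\ sg * (b - u t) != 0].
Proof.
move=> sg1 slack slack0.
have [_ bu] := au.
pose c n : R := n.+1%:R^-1.
pose E n := D `&` [set t | sg * Lambda t <= - c n] `&`
  [set t | c n <= sg * (b - u t)].
have meas_u := admissible_measurable au.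
have mE n : measurable (E n).
  have m1 : measurable_fun D (fun t => sg * Lambda t <= - c n).
    apply: measurable_fun_ler => //.
    by apply: measurable_funM => //; exact: switching_measurable.
  have m2 : measurable_fun D (fun t => c n <= sg * (b - u t)).
    apply: measurable_fun_ler => //; apply: measurable_funM => //.
    exact: measurable_funB.
  have -> : E n = (D `&` [set t | sg * Lambda t <= - c n]) `&`
      (D `&` [set t | c n <= sg * (b - u t)]).
    by rewrite setIACA setIid setIA.
  by apply: measurableI; [exact: (m1 mD [set true])|exact: (m2 mD [set true])].
have c0 n : 0 < c n by rewrite invr_gt0.
have E0 n : mu (E n) = 0%E.
  apply: (weak_minimum_null (mE n) _ (c0 n) sg1).
  - by move=> t [[]].
  - by move=> t [[_ h] _].
  - by move=> t [_ h] hu; apply: slack.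
have nE : mu.-negligible (\bigcup_n E n).
  apply: negligible_bigcup => n; exists (E n); split;
    [exact: mE|exact: E0|by []].
have nb : mu.-negligible (~` [set t | D t -> um <= u t <= uM]) by exact: bu.
apply: negligibleS (negligibleU nb nE) => t [Dt [Lt ut]].
have [hu|hu] := pselect (um <= u t <= uM); last by left => /(_ Dt).
right; pose a := Num.min (- (sg * Lambda t)) (sg * (b - u t)).
have a0 : 0 < a.
  by rewrite /a lt_min oppr_gt0 Lt lt_neqAle eq_sym ut slack0.
have /cvgr0Pnorm_lt/(_ _ a0) h := @cvg_harmonic R.
have [n hn] := filter_ex h.
have {}hn : c n < a by apply: le_lt_trans hn; exact: ler_norm.
move: hn; rewrite lt_min => /andP[h1 h2].
exists n => //; split; first split=> //=.
- by rewrite lerNr ltW.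
- exact: ltW.
Qed.

End WeakMinimum.

Theorem proposition2p17 (R : realType) (H : completeNormedModType R)
    (T : R) (domA : set H) (A : H -> H) (S : R -> 'L(H, H))
    (f : R -> H) (B1 : H) (B2 : 'L(H, H)) (Psi0 : H)
    (Q QT : 'L(H, 'L(H, R^o))) (Psid : R -> H) (PsidT : H)
    (alpha um uM : R) (u : R -> R) (p : R -> 'L(H, R^o)) :
  reflexive_space H ->
  0 < T ->
  C0_semigroup S ->
  generates domA A S ->
  bochner_L1 `]0, T[ f ->
  (forall x y, Q x y = Q y x) ->
  (forall x y, QT x y = QT y x) ->
  bochner_Linfty `]0, T[ Psid ->
  um < uM ->
  let Psi_ := state T S f B1 B2 Psi0 in
  let F := fun v => cost T alpha Q QT Psid PsidT v (Psi_ v) in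
  weak_minimum T um uM F u ->
  let Psi := Psi_ u in
  mild_costate T S B2 Q QT Psid PsidT u Psi p ->
  let Lambda := fun t => alpha + p t (B1 + B2 (Psi t)) in
  lebesgue_measure.-negligible
    ([set t | 0 < t < T /\ Lambda t > 0] `\`
     [set t | 0 < t < T /\ u t = um]) /\
  lebesgue_measure.-negligible
    ([set t | 0 < t < T /\ Lambda t < 0] `\`
     [set t | 0 < t < T /\ u t = uM]).
Proof.
move=> _ T0 C0 _ L1f Qsym QTsym PsidP _ Psi_ F umin Psi pP Lambda.
have null sg b := @weak_minimum_negligible R H S C0 T T0 f B1 B2 Psi0 Q QT Psid
  PsidT alpha um uM u p L1f Qsym QTsym PsidP umin pP sg b.
split.
- apply: negligibleS (null (-1) um _ _ _) => [t [[tT Lt] nu]|||].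
  + split; first by rewrite /= in_itv.
    rewrite mulN1r oppr_lt0; split=> //.
    rewrite mulN1r opprB subr_eq0; apply/eqP => ut; apply: nu; split=> //.
  + by rewrite normrN normr1.
  + by move=> t c c0 /andP[h1 h2] h3; apply/andP; split; lra.
  + by move=> t /andP[h1 h2]; lra.
- apply: negligibleS (null 1 uM _ _ _) => [t [[tT Lt] nu]|||].
  + split; first by rewrite /= in_itv.
    rewrite mul1r; split=> //.
    rewrite mul1r subr_eq0; apply/eqP => ut; apply: nu; split=> //.
  + by rewrite normr1.
  + by move=> t c c0 /andP[h1 h2] h3; apply/andP; split; lra.
  + by move=> t /andP[h1 h2]; lra.
Qed.
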